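(* Let $\overrightarrow T$ be a diagram of an oriented right tangle with boundary $P_n$. The type $D$ structures $\overrightarrow\delta_{\mathcal V}$ and $\overrightarrow\delta_T$ on $\mathcal D(\overrightarrow T)$ satisfy $$(\mu_{\mathcal B\Gamma_n}\otimes\mathbb I)(\mathbb I\otimes\overrightarrow\delta_{\mathcal V})\overrightarrow\delta_T+(\mu_{\mathcal B\Gamma_n}\otimes\mathbb I)(\mathbb I\otimes\overrightarrow\delta_T)\overrightarrow\delta_{\mathcal V}=0,$$ where $\mu_{\mathcal B\Gamma_n}$ is the product of $\mathcal B\Gamma_n$.
   Context: **Cleaved links.** Fix $n\ge 1$, $P_n=\{p_1,\dots,p_{2n}\}$ with $p_i=(0,i)\in\mathbb R^2$; $p_{2n}$ is the marked point. A left (right) planar matching is a proper embedding of $n$ disjoint arcs in $(-\infty,0]\times\mathbb R$ (resp. $[0,\infty)\times\mathbb R$) with endpoint set $P_n$, up to isotopy. An $n$-decorated cleaved link $(L,\sigma)$ is an embedding $L$ of disjoint circles in $\mathbb R^2$, each containing at least two points of $P_n$, with $L\cap(\{0\}\times\mathbb R)=P_n$ (so $L$ is the union of a left matching $\overleftarrow L$ and a right matching $\overrightarrow L$), together with a decoration $\sigma:\mathrm{Cir}(L)\to\{+,-\}$ of its set of circles. The circle through $p_{2n}$ is the marked circle. $\mathcal{CL}_n$ is the set of equivalence (isotopy) classes of $n$-decorated cleaved links whose marked circle is decorated $-$. If $\sigma(C)=+$, $\sigma_C$ is the decoration with $\sigma_C(C)=-$ and equal to $\sigma$ elsewhere. **Bridges.**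 A bridge $\gamma$ of $L$ is (the isotopy class of) an embedded arc in $\mathbb R^2\setminus(\{0\}\times\mathbb R)$ with interior disjoint from $L$ and endpoints on distinct arcs of $\overleftarrow L$ (left bridge) or of $\overrightarrow L$ (right bridge). $L_\gamma$ is the result of surgery of $L$ along $\gamma$ and $\gamma^\dagger$ is the bridge of $L_\gamma$ given by the co-core of the surgery. Khovanov sign rules: a merge sends $++\mapsto +$, $+-\mapsto -$, $-+\mapsto -$, $--\mapsto 0$; a division sends $+\mapsto (+-)+(-+)$, $-\mapsto --$; circles not touching the surgery arc keep their decorations. A decoration is compatible with $\sigma$ if it occurs in the result. $B_d(L,\gamma)$: bridges of $L$ neither of whose ends is on an arc (of $\overleftarrow L$ or $\overrightarrow L$) containing an end of $\gamma$. For left $\gamma$, $B_o(L,\gamma)$ (resp. $B_s(L,\gamma)$): bridges with one end on the same arc as an end of $\gamma$, lying on the opposite (resp. same) side of this arc as $\gamma$. $B_{\pitchfork}(L_\gamma,\gamma^\dagger)$: bridges of $L_\gamma$ all of whose representatives intersect $\gamma^\dagger$. **The algebra $\mathcal B\Gamma_n$** (over $\mathbb Z_2$) is generated by orthogonal idempotents $I_{(L,\sigma)}$, $(L,\sigma)\in\mathcal{CL}_n$ (with sum $1$, spanning the subring $\mathcal I_n$), and elements $e$ with a source $s(e)$ and target $t(e)$ in $\mathcal{CL}_n$, $e=I_{s(e)}eI_{t(e)}$ (so $ef=0$ unless $t(e)=s(f)$): (i) for each circle $C$ with $\sigma(C)=+$, right and left decoration elements $\overrightarrow{e_C},\overleftarrow{e_C}:(L,\sigma)\to(L,\sigma_C)$;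 (ii) for each bridge $\gamma$ of $L$ and each compatible decoration $\sigma_\gamma$ of $L_\gamma$ a bridge element $e_{(\gamma;\sigma,\sigma_\gamma)}:(L,\sigma)\to(L_\gamma,\sigma_\gamma)$, called left/right as $\gamma$ is. Relations (imposed whenever all displayed elements are defined and the products in a relation have the same source and the same target): (1) $e_Ce'_D=e'_De_C$ for distinct $+$ circles $C,D$, where each of $e_C$, $e'_D$ is independently of left or right type (the same type on both sides); (2) $e_{(\gamma;\sigma,\sigma')}e_C=e_Ce_{(\gamma;\sigma_C,\sigma'_C)}$ if $\gamma$ does not touch $C$, $e_C$ of either type (the same on both sides); (3) $e_{(\gamma;\sigma,\sigma')}e_{(\eta;\sigma',\sigma''')}=e_{(\eta;\sigma,\sigma'')}e_{(\gamma;\sigma'',\sigma''')}$ for distinct bridges with $\eta\in B_d(L,\gamma)$; (4) $e_{(\gamma;\sigma,\sigma')}e_{(\delta;\sigma',\sigma''')}=e_{(\eta;\sigma,\sigma'')}e_{(\omega;\sigma'',\sigma''')}$ for right bridges $\gamma\neq\eta$ of $L$, $\delta$ of $L_\gamma$, $\omega$ of $L_\eta$ with $L_{\gamma,\delta}=L_{\eta,\omega}$; (5) the same as (4) for left bridges, if $\eta\in B_o(L,\gamma)$; (6) $e_{(\gamma;\sigma,\sigma')}e_{(\eta;\sigma',\sigma'')}=0$ for $\gamma$ left and $\eta\in B_\pitchfork(L_\gamma,\gamma^\dagger)$; (7) for left bridges with $\alpha\in B_s(L,\beta)$ and $\gamma$ the left bridge obtained by sliding $\alpha$ over $\beta$: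 $e_\alpha e_\beta+e_\beta e_\delta+e_\gamma e_\eta=0$, where $\delta,\eta$ are the images of $\alpha$ in $L_\beta$ and $L_\gamma$; (8) $e_{(\gamma;\sigma,\sigma')}e_{(\gamma^\dagger;\sigma',\sigma_C)}=\overrightarrow{e_C}$ for $\gamma$ a right bridge; (9) if $\gamma$ merges $+$ circles $C_1,C_2$ into $C$: $\overrightarrow{e_{C_1}}e_{(\gamma;\sigma_{C_1},\sigma_{\gamma,C})}=\overrightarrow{e_{C_2}}e_{(\gamma;\sigma_{C_2},\sigma_{\gamma,C})}=e_{(\gamma;\sigma,\sigma_\gamma)}\overrightarrow{e_C}$, where $\sigma_\gamma(C)=+$ and $\sigma_{\gamma,C}(C)=-$; if $\gamma$ divides a $+$ circle $C$ into $C_1,C_2$: $\overrightarrow{e_C}e_{(\gamma;\sigma_C,\sigma_{C,\gamma})}=e_{(\gamma;\sigma,\sigma^1_\gamma)}\overrightarrow{e_{C_1}}=e_{(\gamma;\sigma,\sigma^2_\gamma)}\overrightarrow{e_{C_2}}$, where $\sigma^i_\gamma$ is $+$ on $C_i$ and $-$ on $C_{3-i}$, and $\sigma_{C,\gamma}$ is $-$ on both; (10) in the situations of (9): $\overleftarrow{e_{C_1}}e_{(\gamma;\sigma_{C_1},\sigma_{\gamma,C})}+\overleftarrow{e_{C_2}}e_{(\gamma;\sigma_{C_2},\sigma_{\gamma,C})}+e_{(\gamma;\sigma,\sigma_\gamma)}\overleftarrow{e_C}=0$ and $\overleftarrow{e_C}e_{(\gamma;\sigma_C,\sigma_{C,\gamma})}+e_{(\gamma;\sigma,\sigma^1_\gamma)}\overleftarrow{e_{C_1}}+e_{(\gamma;\sigma,\sigma^2_\gamma)}\overleftarrow{e_{C_2}}=0$.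 Grading $\zeta$: idempotents $0$, decoration elements $1/2$, right bridge elements $1/4$, left bridge elements $3/4$, additive on products. The differential $d_{\Gamma_n}$ (degree $+1$, Leibniz rule) vanishes on all generators except $d_{\Gamma_n}(\overleftarrow{e_C})=\sum e_{(\gamma;\sigma,\sigma_\gamma)}e_{(\gamma^\dagger;\sigma_\gamma,\sigma_C)}$, summed over left bridges $\gamma$ of $L$ with at least one foot on $C$ and all compatible $\sigma_\gamma$. **Right tangles and states.** $\overrightarrow T\subset[0,\infty)\times\mathbb R$ is a diagram of an oriented tangle $\overrightarrow{\mathcal T}\subset[0,\infty)\times\mathbb R^2$ with boundary $P_n$, with $n_\pm$ positive/negative crossings. Its arcs are the segments between crossings and/or points of $P_n$ (a closed component without crossings is one arc); each arc $f$ has a variable $x_f$, and $\mathbb F_{\overrightarrow T}$ is the fraction field of $\mathbb Z_2[x_f]$. A resolution $\rho$ replaces each crossing $c$ by its $0$- or $1$-resolution (standard Khovanov convention), written $\rho(c)\in\{0,1\}$; $h(\rho)$ is the number of $1$'s. At each crossing with $\rho(c)=0$ there is the active resolution bridge, a short arc along which surgery produces the $1$-resolution at $c$. A state $(r,s)$ consists of $r=\overleftarrow m\#\rho$ ($\overleftarrow m$ a left planar matching glued to a resolution $\rho$) and a decoration $s$ of all circles of $r$ by $\pm$, with $-$ on the circle through $p_{2n}$. Circles of $r$ not meeting the $y$-axis are free, the others cleaved. $\partial(r,s)\in\mathcal{CL}_n$ is obtained by deleting free circles. $\mathcal D(\overrightarrow T)$ is the $\mathbb F_{\overrightarrow T}$-vector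 space with basis the states; it is a left $\mathcal I_n$-module by $I_{(L,\sigma)}(r,s)=(r,s)$ if $\partial(r,s)=(L,\sigma)$ and $0$ otherwise. Grading: $\zeta(r,s)=h-q/2$ with $h=h(\rho)-n_-$, $q=h(\rho)+\tfrac12 i(\partial(r,s))+\#\{+\text{ free circles}\}-\#\{-\text{ free circles}\}+n_+-2n_-$, where $i(L,\sigma)$ is the number of $+$ circles minus the number of $-$ non-marked circles. For a circle $C$ of $r$, $\overrightarrow{w_C}$ is the sum of $x_f$ over arcs $f$ of $\overrightarrow T$ lying on $C$; $s_C$ is $s$ with $C$ changed from $+$ to $-$. **The structure maps** (below $\mathcal B\Gamma_n$ means $\mathcal B\Gamma_n\otimes_{\mathbb Z_2}\mathbb F_{\overrightarrow T}$, etc.; $X[k]_i=X_{i-k}$). $\overrightarrow\delta_T:\mathcal D(\overrightarrow T)\to(\mathcal B\Gamma_n\otimes_{\mathcal I_n}\mathcal D(\overrightarrow T))[-1]$ (Roberts's type $D$ structure) is $$\overrightarrow\delta_T(r,s)=\sum_{\gamma}\sum_{s'}e(\gamma,s')\otimes(r_\gamma,s')+\sum_{\eta}\sum_{s'}e_\eta\otimes(r_\eta,s')+\sum_{C\text{ cleaved},\,s(C)=+}\overleftarrow{e_C}\otimes(r,s_C).$$ Here $\gamma$ runs over active resolution bridges of $r$, $\eta$ over left bridges of $\partial(r,s)$, $r_\gamma,r_\eta$ are the results of surgery, $s'$ runs over decorations given by the Khovanov sign rules, $e_\eta$ is the bridge element $\partial(r,s)\to\partial(r_\eta,s')$ for $\eta$,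 and $e(\gamma,s')$ is: the right bridge element $\partial(r,s)\to\partial(r_\gamma,s')$ if surgery changes the right planar matching; $I_{\partial(r,s)}$ if $\partial(r_\gamma,s')=\partial(r,s)$; $\overrightarrow{e_C}$ if the underlying cleaved link is unchanged but the decoration of the cleaved circle $C$ changes from $+$ to $-$. The vertical map is $$\overrightarrow\delta_{\mathcal V}(r,s)=\sum_{C\text{ free},\,s(C)=+}\overrightarrow{w_C}\,I_{\partial(r,s)}\otimes(r,s_C)+\sum_{C\text{ cleaved},\,s(C)=+}\overrightarrow{w_C}\,\overrightarrow{e_C}\otimes(r,s_C).$$ *)

(* Defs.v *)
(** Isotopy classes of planar objects are encoded combinatorially:
    - a planar matching is a fixed-point free noncrossing involution of [P_n];
    - a bridge is determined, up to isotopy, by its side and by the unordered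
      pair of arcs carrying its two ends, these arcs bounding a common region
      of the half-plane (two arcs bound at most one common region, and this
      region is a disc);
    - a right tangle diagram is put in general position with respect to the
      first coordinate, hence is a word in cups, caps and crossings. *)
From HB Require Import structures.
From mathcomp Require Import all_boot all_algebra generic_quotient fraction.
From mathcomp Require Import boolp.
From mathcomp Require Import mpoly.

Set Implicit Arguments.
Unset Strict Implicit.
Unset Printing Implicit Defensive.

Import GRing.Theory.
Local Open Scope ring_scope.
Local Open Scope quotient_scope.

Section PresentedAlgebra.
Variables (K : fieldType) (G : Type).

Inductive expr : Type :=
| EZero | EOne
| EAdd of expr & expr
| EOpp of expr
| EMul of expr & expr
| EScale of K & expr
| EGen of G.

HB.instance Definition _ := gen_eqMixin expr.
HB.instance Definition _ := gen_choiceMixin expr.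

Variable rel0 : expr -> expr -> Prop.

(** The least congruence containing [rel0] and the axioms of associative
    unital [K]-algebras. *)
Inductive congr_expr : expr -> expr -> Prop :=
| CRel a b of rel0 a b : congr_expr a b
| CRefl a : congr_expr a a
| CSym a b of congr_expr a b : congr_expr b a
| CTrans b a c of congr_expr a b & congr_expr b c : congr_expr a c
| CAdd a a' b b' of congr_expr a a' & congr_expr b b' :
    congr_expr (EAdd a b) (EAdd a' b')
| COpp a a' of congr_expr a a' : congr_expr (EOpp a) (EOpp a')
| CMul a a' b b' of congr_expr a a' & congr_expr b b' :
    congr_expr (EMul a b) (EMul a' b')
| CScale k a a' of congr_expr a a' : congr_expr (EScale k a) (EScale k a')
| CaddA a b c : congr_expr (EAdd a (EAdd b c)) (EAdd (EAdd a b) c)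
| CaddC a b : congr_expr (EAdd a b) (EAdd b a)
| Cadd0 a : congr_expr (EAdd EZero a) a
| CaddN a : congr_expr (EAdd (EOpp a) a) EZero
| CmulA a b c : congr_expr (EMul a (EMul b c)) (EMul (EMul a b) c)
| Cmul1l a : congr_expr (EMul EOne a) a
| Cmul1r a : congr_expr (EMul a EOne) a
| CmulDl a b c : congr_expr (EMul (EAdd a b) c) (EAdd (EMul a c) (EMul b c))
| CmulDr a b c : congr_expr (EMul a (EAdd b c)) (EAdd (EMul a b) (EMul a c))
| CscaleA k l a : congr_expr (EScale k (EScale l a)) (EScale (k * l) a)
| Cscale1 a : congr_expr (EScale 1 a) a
| CscaleDr k a b :
    congr_expr (EScale k (EAdd a b)) (EAdd (EScale k a) (EScale k b))
| CscaleDl k l a :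
    congr_expr (EScale (k + l) a) (EAdd (EScale k a) (EScale l a))
| CscaleAl k a b : congr_expr (EScale k (EMul a b)) (EMul (EScale k a) b)
| CscaleAr k a b : congr_expr (EScale k (EMul a b)) (EMul a (EScale k b)).

Definition congr_exprb (a b : expr) : bool := `[< congr_expr a b >].

Lemma congr_exprb_equiv : equiv_class_of congr_exprb.
Proof.
split=> [a|a b|b a c].
- exact/asboolP/CRefl.
- by apply/asboolP/asboolP; apply: CSym.
- by move=> /asboolP ab /asboolP bc; apply/asboolP; apply: CTrans ab bc.
Qed.

Canonical congr_expr_equiv := EquivRelPack congr_exprb_equiv.

Definition presented : Type := {eq_quot congr_expr_equiv}.
HB.instance Definition _ := Choice.on presented.

Definition class_of (a : expr) : presented := \pi_{eq_quot congr_expr_equiv} a.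
Definition expr_of (x : presented) : expr := repr x.

Lemma expr_ofK x : class_of (expr_of x) = x. Proof. exact: reprK. Qed.

Lemma class_ofP a b : class_of a = class_of b <-> congr_expr a b.
Proof.
split=> [/eqP|ab]; first by rewrite /class_of eqmodE => /asboolP.
by apply/eqP; rewrite /class_of eqmodE; apply/asboolP.
Qed.

Lemma expr_of_class a : congr_expr (expr_of (class_of a)) a.
Proof. by apply/class_ofP; rewrite expr_ofK. Qed.

Lemma presentedW (P : presented -> Prop) :
  (forall a, P (class_of a)) -> forall x, P x.
Proof. by move=> Pc x; rewrite -[x]expr_ofK. Qed.

Definition padd x y := class_of (EAdd (expr_of x) (expr_of y)).
Definition popp x := class_of (EOpp (expr_of x)).
Definition pmul x y := class_of (EMul (expr_of x) (expr_of y)).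
Definition pscale k x := class_of (EScale k (expr_of x)).

Lemma paddE a b : padd (class_of a) (class_of b) = class_of (EAdd a b).
Proof. by apply/class_ofP; apply: CAdd; apply: expr_of_class. Qed.
Lemma poppE a : popp (class_of a) = class_of (EOpp a).
Proof. by apply/class_ofP; apply: COpp; apply: expr_of_class. Qed.
Lemma pmulE a b : pmul (class_of a) (class_of b) = class_of (EMul a b).
Proof. by apply/class_ofP; apply: CMul; apply: expr_of_class. Qed.
Lemma pscaleE k a : pscale k (class_of a) = class_of (EScale k a).
Proof. by apply/class_ofP; apply: CScale; apply: expr_of_class. Qed.

Definition presentedE := (paddE, poppE, pmulE, pscaleE).

Local Ltac by_axiom c :=
  repeat (elim/presentedW; intro); rewrite ?presentedE; apply/class_ofP;
  by apply c.

Lemma paddA : associative padd. Proof. by by_axiom CaddA. Qed.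
Lemma paddC : commutative padd. Proof. by by_axiom CaddC. Qed.
Lemma padd0 : left_id (class_of EZero) padd. Proof. by by_axiom Cadd0. Qed.
Lemma paddN : left_inverse (class_of EZero) popp padd.
Proof. by by_axiom CaddN. Qed.

HB.instance Definition _ := GRing.isZmodule.Build presented
  paddA paddC padd0 paddN.

Lemma pmulA : associative pmul. Proof. by by_axiom CmulA. Qed.
Lemma pmul1l : left_id (class_of EOne) pmul. Proof. by by_axiom Cmul1l. Qed.
Lemma pmul1r : right_id (class_of EOne) pmul. Proof. by by_axiom Cmul1r. Qed.
Lemma pmulDl : left_distributive pmul padd. Proof. by by_axiom CmulDl. Qed.
Lemma pmulDr : right_distributive pmul padd. Proof. by by_axiom CmulDr. Qed.

HB.instance Definition _ := GRing.Zmodule_isPzRing.Build presented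
  pmulA pmul1l pmul1r pmulDl pmulDr.

Lemma pscaleA k l x : pscale k (pscale l x) = pscale (k * l) x.
Proof. by move: x; by_axiom CscaleA. Qed.
Lemma pscale1 : left_id 1 pscale. Proof. by by_axiom Cscale1. Qed.
Lemma pscaleDr : right_distributive pscale padd.
Proof. by move=> k; by_axiom CscaleDr. Qed.
Lemma pscaleDl x : {morph pscale^~ x : k l / k + l >-> padd k l}.
Proof. by move=> k l; move: x; by_axiom CscaleDl. Qed.

HB.instance Definition _ := GRing.Zmodule_isLmodule.Build K presented
  pscaleA pscale1 pscaleDr pscaleDl.

(** The library's algebra structures require [1 != 0], which depends on the
    presentation; the two compatibility laws are therefore kept as lemmas. *)
Lemma presented_scaleAl k (x y : presented) : k *: (x * y) = (k *: x) * y.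
Proof.
by move: x y; rewrite /GRing.scale /GRing.mul /=; by_axiom CscaleAl.
Qed.
Lemma presented_scaleAr k (x y : presented) : k *: (x * y) = x * (k *: y).
Proof.
by move: x y; rewrite /GRing.scale /GRing.mul /=; by_axiom CscaleAr.
Qed.

Lemma class_of0 : class_of EZero = 0. Proof. by []. Qed.
Lemma class_of1 : class_of EOne = 1. Proof. by []. Qed.
Lemma class_ofD a b : class_of (EAdd a b) = class_of a + class_of b.
Proof. by rewrite -paddE. Qed.
Lemma class_ofM a b : class_of (EMul a b) = class_of a * class_of b.
Proof. by rewrite -pmulE. Qed.

Lemma presented_rel a b : rel0 a b -> class_of a = class_of b.
Proof. by move=> ab; apply/class_ofP; apply: CRel. Qed.

End PresentedAlgebra.

Arguments EZero {K G}.
Arguments EOne {K G}.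

(** The point [p_(i+1)] of [P_n] is the ordinal [i]; the marked point [p_(2n)]
    is the last one. *)
Notation pt n := 'I_(n.*2).

Definition is_marked n (p : pt n) : bool := p.+1 == n.*2 :> nat.

Definition planar_matching n (m : {ffun pt n -> pt n}) : bool :=
  [forall i, (m i != i) && (m (m i) == i)] &&
  [forall i : pt n, forall j : pt n,
     ~~ [&& (i < j)%N, (j < m i)%N & (m i < m j)%N]].

Record matching n := Matching {
  partner :> {ffun pt n -> pt n};
  _ : planar_matching partner }.

HB.instance Definition _ n := [isSub for @partner n].
HB.instance Definition _ n := [Finite of matching n by <:].

Definition arc n (m : matching n) (i : pt n) : {set pt n} := [set i; m i].
Definition arcs n (m : matching n) : {set {set pt n}} := [set arc m i | i : pt n].

Notation Left := true (only parsing).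
Notation Right := false (only parsing).

(** A cleaved link, as its left and its right planar matching. *)
Definition link n : predArgType := (matching n * matching n)%type.
Definition side_of n (b : bool) (L : link n) : matching n :=
  if b then L.1 else L.2.

(** A circle of a link is recorded by the set of its points on the axis. *)
Definition link_rel n (L : link n) : rel (pt n) :=
  [rel i j | (j == L.1 i) || (j == L.2 i)].
Definition link_circle n (L : link n) (i : pt n) : {set pt n} :=
  [set j | connect (link_rel L) i j].
Definition link_circles n (L : link n) : {set {set pt n}} :=
  [set link_circle L i | i : pt n].

(** A decoration (with [true] for + and [false] for -) of the set of circles
    is a function on [P_n] that is constant along the circles. *)
Definition is_decoration n (x : link n * {ffun pt n -> bool}) : bool :=
  [forall i, (x.2 (x.1.1 i) == x.2 i) && (x.2 (x.1.2 i) == x.2 i)] &&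
  [forall i, is_marked i ==> ~~ x.2 i].

Record cleaved_link n := CleavedLink {
  cl_val :> link n * {ffun pt n -> bool};
  _ : is_decoration cl_val }.

HB.instance Definition _ n := [isSub for @cl_val n].
HB.instance Definition _ n := [Finite of cleaved_link n by <:].

Definition link_of n (x : cleaved_link n) : link n := (cl_val x).1.
Definition dec_of n (x : cleaved_link n) : {ffun pt n -> bool} := (cl_val x).2.

Definition merge_rule (s1 s2 s : bool) : bool :=
  match s1, s2 with
  | true, true => s
  | true, false | false, true => ~~ s
  | false, false => false
  end.

Definition division_rule (s s1 s2 : bool) : bool :=
  if s then s1 (+) s2 else ~~ s1 && ~~ s2.

Section Khovanov.
Variable V : finType.

(** The elements of [F] lie on exactly one, resp. on exactly the two distinct
    components of [u] and [v]. *)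
Definition on_one_circle (e : rel V) (F : {set V}) : bool :=
  [forall u in F, forall v in F, connect e u v].
Definition on_two_circles (e : rel V) (F : {set V}) (u v : V) : bool :=
  ~~ connect e u v && [forall w in F, connect e u w || connect e v w].

(** [s'] is compatible with [s] for a surgery changing the circles, i.e. the
    components, of [e] to those of [e'], where [F] is the set of ends of the
    strands that are cut and reconnected. *)
Definition khovanov (e e' : rel V) (F : {set V}) (s s' : V -> bool) : bool :=
  [forall v, [forall u in F, ~~ connect e u v] ==> (s' v == s v)] &&
  ([exists u in F, exists v in F,
      [&& on_two_circles e F u v, on_one_circle e' F
        & merge_rule (s u) (s v) (s' u)]] ||
   [exists u in F, exists v in F,
      [&& on_one_circle e F, on_two_circles e' F u v
        & division_rule (s u) (s' u) (s' v)]]).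

End Khovanov.

Section Bridges.
Variable n : nat.
Implicit Types (m : matching n) (a b c : {set pt n}) (A B : {set {set pt n}}).

(** [i] lies strictly between the two ends of the arc [a]. *)
Definition under a (i : pt n) : bool :=
  [exists p in a, exists q in a, (p < i)%N && (i < q)%N].

(** For disjoint arcs [a] and [b] of a matching, [b] lies under [a]. *)
Definition arc_under a b : bool := [exists i in b, under a i].

(** A bridge on one side of the axis, as the set of the two arcs carrying its
    ends: no third arc separates these two arcs. *)
Definition is_bridge m A : bool :=
  [exists a in arcs m, exists b in arcs m,
    [&& a != b, A == [set a; b] &
        [forall c in arcs m, (c \notin A) ==> (arc_under c a == arc_under c b)]]].

(** Surgery reconnects the four ends of the two arcs; there is exactly one
    other way to do so that is planar, and [m'] is a planar matching. *)
Definition is_surgery m A m' : bool :=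
  [forall i, if i \in cover A then m' i \in cover A :\: arc m i
             else m' i == m i].

(** The co-core [A^dagger] joins the two new arcs of the surgered matching
    [m']. *)
Definition dagger m' A : {set {set pt n}} := [set arc m' i | i in cover A].

(** [B] has exactly one end on an arc carrying an end of [A]; if [same] then
    both bridges lie on the same side of this arc, otherwise they lie on
    opposite sides of it. *)
Definition shares_arc (same : bool) A B : bool :=
  [exists a in A, exists b in A, exists c in B,
    [&& A == [set a; b], B == [set a; c], a != b, a != c, b != c
      & (arc_under a b == arc_under a c) == same]].

(** All representatives of the bridge [B] intersect [A]: the four arcs are
    distinct and their cyclic order around the common region interleaves the
    ends of [A] and [B]. *)
Definition interleaved A B : bool :=
  [exists i in cover A, exists j in cover A, exists k in cover B,
   exists l in cover B,
    [&& (i < k)%N, (k < j)%N, (j < l)%N, [set i; j] \notin A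
      & [set k; l] \notin B]].
Definition transverse A B : bool :=
  [disjoint A & B] && (interleaved A B || interleaved B A).

(** For bridges [A] and [B] on the same side of a shared arc, the image [B']
    of [B] after surgery along [A]: the end of [B] on the arc that is not
    shared stays there, the other one is carried to one of the new arcs. Only
    one of the two new arcs gives a bridge of the surgered matching [m']. *)
Definition is_image m' A B B' : bool :=
  [&& is_bridge m' B', B' :&: dagger m' A != set0 & B' :&: (B :\: A) != set0].

(** The bridge obtained by sliding [A] over [B] along their shared arc. *)
Definition slide A B : {set {set pt n}} := (A :\: B) :|: (B :\: A).

End Bridges.

(** [Idem x] is the idempotent [I_x].
    [Dec b x C y] is the decoration element of side [b] and circle [C] from
    [x] to [y].
    [Bri b A x y] is the bridge element of side [b] and bridge [A] from [x] to
    [y]. *)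
Variant symbol n : Type :=
| Idem of cleaved_link n
| Dec of bool & cleaved_link n & {set pt n} & cleaved_link n
| Bri of bool & {set {set pt n}} & cleaved_link n & cleaved_link n.

Section Algebra.
Variable n : nat.
Implicit Types (x y z : cleaved_link n) (C D : {set pt n}).
Implicit Types (A B : {set {set pt n}}) (b : bool).

Definition source (g : symbol n) : cleaved_link n :=
  match g with Idem x | Dec _ x _ _ | Bri _ _ x _ => x end.
Definition target (g : symbol n) : cleaved_link n :=
  match g with Idem y | Dec _ _ _ y | Bri _ _ _ y => y end.

(** [C] is a + circle of [x], and [y] is [x] with [C] redecorated by -. *)
Definition is_dec_step x C y : bool :=
  [&& C \in link_circles (link_of x), [forall i in C, dec_of x i],
      link_of y == link_of x
    & dec_of y == [ffun i => dec_of x i && (i \notin C)]].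

Definition is_bridge_step b A x y : bool :=
  [&& is_bridge (side_of b (link_of x)) A,
      is_surgery (side_of b (link_of x)) A (side_of b (link_of y)),
      side_of (~~ b) (link_of y) == side_of (~~ b) (link_of x)
    & khovanov (link_rel (link_of x)) (link_rel (link_of y)) (cover A)
        (dec_of x) (dec_of y)].

Definition denotes (g : symbol n) : bool :=
  match g with
  | Idem _ => true
  | Dec _ x C y => is_dec_step x C y
  | Bri b A x y => is_bridge_step b A x y
  end.

Definition generator : Type := {g : symbol n | denotes g}.

Variable K : fieldType.

Definition sym (g : symbol n) : expr K generator :=
  if insub g is Some h then EGen K h else EZero.

Local Notation "a '+e' b" := (EAdd a b) (at level 50, left associativity).
Local Notation "g '*e' h" := (EMul (sym g) (sym h)) (at level 40).

Definition sum_idem : expr K generator :=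
  foldr (fun x e => sym (Idem x) +e e) EZero (enum {: cleaved_link n}).

(** The defining relations; [R0_*] express that the [I_x] are orthogonal
    idempotents with sum [1] and that [e = I_(s e) e I_(t e)]. *)
Inductive relation : expr K generator -> expr K generator -> Prop :=
| R0_idem x : relation (Idem x *e Idem x) (sym (Idem x))
| R0_orth x y of x != y : relation (Idem x *e Idem y) EZero
| R0_sum : relation sum_idem EOne
| R0_source g of denotes g : relation (Idem (source g) *e g) (sym g)
| R0_target g of denotes g : relation (g *e Idem (target g)) (sym g)

| R1 b b' x y y' z C D of C != D
    & denotes (Dec b x C y) & denotes (Dec b' y D z)
    & denotes (Dec b' x D y') & denotes (Dec b y' C z) :
    relation (Dec b x C y *e Dec b' y D z) (Dec b' x D y' *e Dec b y' C z)

| R2 b b' A x y y' z C of [disjoint cover A & C]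
    & denotes (Bri b A x y) & denotes (Dec b' y C z)
    & denotes (Dec b' x C y') & denotes (Bri b A y' z) :
    relation (Bri b A x y *e Dec b' y C z) (Dec b' x C y' *e Bri b A y' z)

| R3 b b' A B x y y' z of (b == b') ==> [disjoint A & B]
    & denotes (Bri b A x y) & denotes (Bri b' B y z)
    & denotes (Bri b' B x y') & denotes (Bri b A y' z) :
    relation (Bri b A x y *e Bri b' B y z) (Bri b' B x y' *e Bri b A y' z)

| R4 A A' B B' x y y' z of A != B
    & denotes (Bri Right A x y) & denotes (Bri Right A' y z)
    & denotes (Bri Right B x y') & denotes (Bri Right B' y' z) :
    relation (Bri Right A x y *e Bri Right A' y z)
             (Bri Right B x y' *e Bri Right B' y' z)

| R5 A A' B B' x y y' z of shares_arc false A B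
    & denotes (Bri Left A x y) & denotes (Bri Left A' y z)
    & denotes (Bri Left B x y') & denotes (Bri Left B' y' z) :
    relation (Bri Left A x y *e Bri Left A' y z)
             (Bri Left B x y' *e Bri Left B' y' z)

| R6 A B x y z of transverse (dagger (side_of Left (link_of y)) A) B
    & denotes (Bri Left A x y) & denotes (Bri Left B y z) :
    relation (Bri Left A x y *e Bri Left B y z) EZero

| R7 A A1 A2 B B1 x x1 x2 x3 z of shares_arc true B A
    & is_image (side_of Left (link_of x1)) A B B1
    & is_image (side_of Left (link_of x2)) B A A1
    & is_image (side_of Left (link_of x3)) (slide A B) A A2
    & denotes (Bri Left A x x1) & denotes (Bri Left B1 x1 z)
    & denotes (Bri Left B x x2) & denotes (Bri Left A1 x2 z)
    & denotes (Bri Left (slide A B) x x3) & denotes (Bri Left A2 x3 z) :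
    relation (Bri Left A x x1 *e Bri Left B1 x1 z
              +e Bri Left B x x2 *e Bri Left A1 x2 z
              +e Bri Left (slide A B) x x3 *e Bri Left A2 x3 z) EZero

| R8 A x y z C of denotes (Bri Right A x y)
    & denotes (Bri Right (dagger (side_of Right (link_of y)) A) y z)
    & denotes (Dec Right x C z) :
    relation (Bri Right A x y
              *e Bri Right (dagger (side_of Right (link_of y)) A) y z)
             (sym (Dec Right x C z))

(** In the merging relations, the circles [C1] and [C2] of [x] merge into the
    circle [C] of [y]; all three are decorated by + when the displayed elements
    are defined. Exchanging [C1] and [C2] gives the other equality. *)
| R9_merge b A x x1 y z C1 C2 C of C1 != C2 & C == C1 :|: C2
    & C2 \in link_circles (link_of x)
    & denotes (Dec Right x C1 x1) & denotes (Bri b A x1 z)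
    & denotes (Bri b A x y) & denotes (Dec Right y C z) :
    relation (Dec Right x C1 x1 *e Bri b A x1 z)
             (Bri b A x y *e Dec Right y C z)

| R9_divide b A x x' y z C C1 C2 of C1 != C2 & C == C1 :|: C2
    & C2 \in link_circles (link_of y)
    & denotes (Dec Right x C x') & denotes (Bri b A x' z)
    & denotes (Bri b A x y) & denotes (Dec Right y C1 z) :
    relation (Dec Right x C x' *e Bri b A x' z)
             (Bri b A x y *e Dec Right y C1 z)

| R10_merge b A x x1 x2 y z C1 C2 C of C1 != C2 & C == C1 :|: C2
    & denotes (Dec Left x C1 x1) & denotes (Bri b A x1 z)
    & denotes (Dec Left x C2 x2) & denotes (Bri b A x2 z)
    & denotes (Bri b A x y) & denotes (Dec Left y C z) :
    relation (Dec Left x C1 x1 *e Bri b A x1 z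
              +e Dec Left x C2 x2 *e Bri b A x2 z
              +e Bri b A x y *e Dec Left y C z) EZero

| R10_divide b A x x' y1 y2 z C C1 C2 of C1 != C2 & C == C1 :|: C2
    & denotes (Dec Left x C x') & denotes (Bri b A x' z)
    & denotes (Bri b A x y1) & denotes (Dec Left y1 C1 z)
    & denotes (Bri b A x y2) & denotes (Dec Left y2 C2 z) :
    relation (Dec Left x C x' *e Bri b A x' z
              +e Bri b A x y1 *e Dec Left y1 C1 z
              +e Bri b A x y2 *e Dec Left y2 C2 z) EZero.

(** For a field [K] of characteristic 2, the algebra over [K] with this
    presentation is the extension of scalars to [K] of the algebra over [Z/2]
    with the same presentation. *)
Definition BGamma : Type := presented relation.
HB.instance Definition _ := GRing.PzRing.copy BGamma (presented relation).
HB.instance Definition _ := GRing.Lmodule.copy BGamma (presented relation).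

(** [elt g] is [0] when the symbol [g] does not denote a generator. *)
Definition elt (g : symbol n) : BGamma := class_of relation (sym g).
Definition idem x : BGamma := elt (Idem x).

Lemma elt_denotes_rel g (e : expr K generator) :
  (denotes g -> relation e (sym g)) -> elt g = 0 \/ class_of relation e = elt g.
Proof.
move=> rg; case hg: (denotes g); last by left; rewrite /elt /sym insubF.
by right; apply: presented_rel; apply: rg.
Qed.

Lemma idem_source g : idem (source g) * elt g = elt g.
Proof.
have [->|] := elt_denotes_rel (@R0_source g); first exact: mulr0.
by rewrite class_ofM.
Qed.

Lemma idem_mul x y : idem x * idem y = if x == y then idem x else 0.
Proof.
case: eqP => [<-|/eqP xy].
  by have /presented_rel := R0_idem x; rewrite class_ofM.
by have /presented_rel := R0_orth xy; rewrite class_ofM.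
Qed.

Lemma idem_elt x g : idem x * elt g = if x == source g then elt g else 0.
Proof.
by rewrite -idem_source mulrA idem_mul; case: eqP => [->|]; rewrite ?mul0r.
Qed.

Lemma sum_idemE : \sum_x idem x = 1.
Proof.
rewrite -class_of1 -(presented_rel R0_sum) /sum_idem /index_enum.
rewrite -enumT; elim: (enum _) => [|x s IHs] /=; first by rewrite big_nil.
by rewrite big_cons IHs class_ofD.
Qed.

End Algebra.

Section Tensor.
Variables (n : nat) (K : fieldType).
Local Notation B := (BGamma n K).
Local Notation I := (@idem n K).

(** A left module over the subring [I_n] spanned by the idempotents. *)
Record imod := Imod {
  icar :> lmodType K;
  iact : cleaved_link n -> {linear icar -> icar};
  iact_mul : forall x y v, iact x (iact y v) = if x == y then iact x v else 0;
  iact_sum : forall v, \sum_x iact x v = v }.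

Arguments iact {i} x : rename.

Record ihom (N N' : imod) := Ihom {
  ihom_fun :> {linear N -> N'};
  ihomI : forall x v, ihom_fun (iact x v) = iact x (ihom_fun v) }.

Section TensorProduct.
Variable N : imod.

Inductive texpr : Type :=
| TZero
| TAdd of texpr & texpr
| TScale of K & texpr
| TPure of B & N.

HB.instance Definition _ := gen_eqMixin texpr.
HB.instance Definition _ := gen_choiceMixin texpr.

(** The congruence defining the tensor product over [I_n] of the right module
    [B] and the left module [N]. *)
Inductive congr_tens : texpr -> texpr -> Prop :=
| TRefl a : congr_tens a a
| TSym a b of congr_tens a b : congr_tens b a
| TTrans b a c of congr_tens a b & congr_tens b c : congr_tens a c
| TcongrD a a' b b' of congr_tens a a' & congr_tens b b' :
    congr_tens (TAdd a b) (TAdd a' b')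
| TcongrZ k a a' of congr_tens a a' : congr_tens (TScale k a) (TScale k a')
| TaddA a b c : congr_tens (TAdd a (TAdd b c)) (TAdd (TAdd a b) c)
| TaddC a b : congr_tens (TAdd a b) (TAdd b a)
| Tadd0 a : congr_tens (TAdd TZero a) a
| TaddN a : congr_tens (TAdd (TScale (-1) a) a) TZero
| TscaleA k l a : congr_tens (TScale k (TScale l a)) (TScale (k * l) a)
| Tscale1 a : congr_tens (TScale 1 a) a
| TscaleDr k a b :
    congr_tens (TScale k (TAdd a b)) (TAdd (TScale k a) (TScale k b))
| TscaleDl k l a :
    congr_tens (TScale (k + l) a) (TAdd (TScale k a) (TScale l a))
| TpureDl a b v :
    congr_tens (TPure (a + b) v) (TAdd (TPure a v) (TPure b v))
| TpureDr a v w :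
    congr_tens (TPure a (v + w)) (TAdd (TPure a v) (TPure a w))
| TpureZl k a v : congr_tens (TPure (k *: a) v) (TScale k (TPure a v))
| TpureZr k a v : congr_tens (TPure a (k *: v)) (TScale k (TPure a v))
| TpureI a x v : congr_tens (TPure (a * I x) v) (TPure a (iact x v)).

Definition congr_tensb (a b : texpr) : bool := `[< congr_tens a b >].

Lemma congr_tensb_equiv : equiv_class_of congr_tensb.
Proof.
split=> [a|a b|b a c].
- exact/asboolP/TRefl.
- by apply/asboolP/asboolP; apply: TSym.
- by move=> /asboolP ab /asboolP bc; apply/asboolP; apply: TTrans ab bc.
Qed.

Canonical congr_tens_equiv := EquivRelPack congr_tensb_equiv.

Definition tens : Type := {eq_quot congr_tens_equiv}.
HB.instance Definition _ := Choice.on tens.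

Definition tclass (a : texpr) : tens := \pi_{eq_quot congr_tens_equiv} a.
Definition texpr_of (x : tens) : texpr := repr x.

Lemma texpr_ofK x : tclass (texpr_of x) = x. Proof. exact: reprK. Qed.

Lemma tclassP a b : tclass a = tclass b <-> congr_tens a b.
Proof.
split=> [/eqP|ab]; first by rewrite /tclass eqmodE => /asboolP.
by apply/eqP; rewrite /tclass eqmodE; apply/asboolP.
Qed.

Lemma texpr_of_class a : congr_tens (texpr_of (tclass a)) a.
Proof. by apply/tclassP; rewrite texpr_ofK. Qed.

Lemma tensW (P : tens -> Prop) : (forall a, P (tclass a)) -> forall x, P x.
Proof. by move=> Pc x; rewrite -[x]texpr_ofK. Qed.

Definition tadd x y := tclass (TAdd (texpr_of x) (texpr_of y)).
Definition tscale k x := tclass (TScale k (texpr_of x)).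

Lemma taddE a b : tadd (tclass a) (tclass b) = tclass (TAdd a b).
Proof. by apply/tclassP; apply: TcongrD; apply: texpr_of_class. Qed.
Lemma tscaleE k a : tscale k (tclass a) = tclass (TScale k a).
Proof. by apply/tclassP; apply: TcongrZ; apply: texpr_of_class. Qed.

Local Ltac by_axiom c :=
  repeat (elim/tensW; intro); rewrite ?(taddE, tscaleE); apply/tclassP;
  by apply c.

Lemma taddA : associative tadd. Proof. by by_axiom TaddA. Qed.
Lemma taddC : commutative tadd. Proof. by by_axiom TaddC. Qed.
Lemma tadd0 : left_id (tclass TZero) tadd. Proof. by by_axiom Tadd0. Qed.
Lemma taddN : left_inverse (tclass TZero) (tscale (-1)) tadd.
Proof. by by_axiom TaddN. Qed.

HB.instance Definition _ := GRing.isZmodule.Build tens taddA taddC tadd0 taddN.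

Lemma tscaleA k l x : tscale k (tscale l x) = tscale (k * l) x.
Proof. by move: x; by_axiom TscaleA. Qed.
Lemma tscale1 : left_id 1 tscale. Proof. by by_axiom Tscale1. Qed.
Lemma tscaleDr : right_distributive tscale tadd.
Proof. by move=> k; by_axiom TscaleDr. Qed.
Lemma tscaleDl x : {morph tscale^~ x : k l / k + l >-> tadd k l}.
Proof. by move=> k l; move: x; by_axiom TscaleDl. Qed.

HB.instance Definition _ := GRing.Zmodule_isLmodule.Build K tens
  tscaleA tscale1 tscaleDr tscaleDl.

Definition pure (a : B) (v : N) : tens := tclass (TPure a v).

Lemma tclassD a b : tclass (TAdd a b) = tclass a + tclass b.
Proof. by rewrite -taddE. Qed.
Lemma tclassZ k a : tclass (TScale k a) = k *: tclass a.
Proof. by rewrite -tscaleE. Qed.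

Lemma pureDl a b v : pure (a + b) v = pure a v + pure b v.
Proof. by rewrite /pure -tclassD; apply/tclassP; apply: TpureDl. Qed.
Lemma pureDr a v w : pure a (v + w) = pure a v + pure a w.
Proof. by rewrite /pure -tclassD; apply/tclassP; apply: TpureDr. Qed.
Lemma pureZl k a v : pure (k *: a) v = k *: pure a v.
Proof. by rewrite /pure -tclassZ; apply/tclassP; apply: TpureZl. Qed.
Lemma pureZr k a v : pure a (k *: v) = k *: pure a v.
Proof. by rewrite /pure -tclassZ; apply/tclassP; apply: TpureZr. Qed.
Lemma pureI a x v : pure (a * I x) v = pure a (iact x v).
Proof. by apply/tclassP; apply: TpureI. Qed.
Lemma pure0l v : pure 0 v = 0.
Proof. by rewrite -(scale0r (0 : B)) pureZl scale0r. Qed.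
Lemma pure0r a : pure a 0 = 0.
Proof. by rewrite -(scale0r (0 : N)) pureZr scale0r. Qed.

Lemma tens_ind (P : tens -> Prop) :
  P 0 -> (forall t u, P t -> P u -> P (t + u)) ->
  (forall k t, P t -> P (k *: t)) -> (forall a v, P (pure a v)) ->
  forall t, P t.
Proof.
move=> P0 PD PZ Pp; elim/tensW; elim=> [|a Pa b Pb|k a Pa|a v] //.
- by rewrite tclassD; apply: PD.
- by rewrite tclassZ; apply: PZ.
- exact: Pp.
Qed.

Section Lift.
Variables (W : lmodType K) (phi : B -> N -> W).
Hypothesis phiDl : forall a b v, phi (a + b) v = phi a v + phi b v.
Hypothesis phiDr : forall a v w, phi a (v + w) = phi a v + phi a w.
Hypothesis phiZl : forall k a v, phi (k *: a) v = k *: phi a v.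
Hypothesis phiZr : forall k a v, phi a (k *: v) = k *: phi a v.
Hypothesis phiI : forall a x v, phi (a * I x) v = phi a (iact x v).

Fixpoint teval (t : texpr) : W :=
  match t with
  | TZero => 0
  | TAdd a b => teval a + teval b
  | TScale k a => k *: teval a
  | TPure a v => phi a v
  end.

Lemma teval_congr a b : congr_tens a b -> teval a = teval b.
Proof.
elim=> //= {a b}.
- by move=> b a c _ -> _ ->.
- by move=> a a' b b' _ -> _ ->.
- by move=> k a a' _ ->.
- by move=> a b c; rewrite addrA.
- by move=> a b; rewrite addrC.
- by move=> a; rewrite add0r.
- by move=> a; rewrite scaleN1r addNr.
- by move=> k l a; rewrite scalerA.
- by move=> a; rewrite scale1r.
- by move=> k a b; rewrite scalerDr.
- by move=> k l a; rewrite scalerDl.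
Qed.

Definition lift_fun (t : tens) : W := teval (texpr_of t).

Lemma lift_class a : lift_fun (tclass a) = teval a.
Proof. by apply: teval_congr; apply: texpr_of_class. Qed.

Lemma lift_linear : linear lift_fun.
Proof.
move=> k; elim/tensW=> a; elim/tensW=> b.
by rewrite -tclassZ -tclassD !lift_class.
Qed.

HB.instance Definition _ := GRing.isLinear.Build K tens W _ _ lift_linear.

Definition lift : {linear tens -> W} := lift_fun.

Lemma lift_pure a v : lift (pure a v) = phi a v.
Proof. exact: lift_class. Qed.

End Lift.

Section LeftMultiplication.
Variable a : B.
Definition lmul_phi (b : B) (v : N) : tens := pure (a * b) v.
Fact lmulDl b c v : lmul_phi (b + c) v = lmul_phi b v + lmul_phi c v.
Proof. by rewrite /lmul_phi mulrDr pureDl. Qed.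
Fact lmulDr b v w : lmul_phi b (v + w) = lmul_phi b v + lmul_phi b w.
Proof. exact: pureDr. Qed.
Fact lmulZl k b v : lmul_phi (k *: b) v = k *: lmul_phi b v.
Proof. by rewrite /lmul_phi -presented_scaleAr pureZl. Qed.
Fact lmulZr k b v : lmul_phi b (k *: v) = k *: lmul_phi b v.
Proof. exact: pureZr. Qed.
Fact lmulI b x v : lmul_phi (b * I x) v = lmul_phi b (iact x v).
Proof. by rewrite /lmul_phi mulrA pureI. Qed.
Definition lmul : {linear tens -> tens} := lift lmulDl lmulDr lmulZl lmulZr lmulI.
End LeftMultiplication.

Lemma lmul_pure a b v : lmul a (pure b v) = pure (a * b) v.
Proof. exact: lift_pure. Qed.

Lemma lmulDt a t u : lmul a (t + u) = lmul a t + lmul a u.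
Proof. exact: linearD. Qed.
Lemma lmulZt a k t : lmul a (k *: t) = k *: lmul a t.
Proof. exact: linearZZ. Qed.
Lemma lmul0t a : lmul a 0 = 0.
Proof. exact: linear0. Qed.

Lemma lmulD a b t : lmul (a + b) t = lmul a t + lmul b t.
Proof.
elim/tens_ind: t => [|t u IHt IHu|k t IHt|c v].
- by rewrite !lmul0t addr0.
- by rewrite !lmulDt IHt IHu addrACA.
- by rewrite !lmulZt IHt scalerDr.
- by rewrite !lmul_pure mulrDl pureDl.
Qed.

Lemma lmulZ k a t : lmul (k *: a) t = k *: lmul a t.
Proof.
elim/tens_ind: t => [|t u IHt IHu|l t IHt|c v].
- by rewrite !lmul0t ?scaler0.
- by rewrite !lmulDt IHt IHu scalerDr.
- by rewrite !lmulZt IHt !scalerA mulrC.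
- by rewrite !lmul_pure -presented_scaleAl pureZl.
Qed.

Lemma lmulM a b t : lmul (a * b) t = lmul a (lmul b t).
Proof.
elim/tens_ind: t => [|t u IHt IHu|l t IHt|c v].
- by rewrite !lmul0t.
- by rewrite !lmulDt IHt IHu.
- by rewrite !lmulZt IHt.
- by rewrite !lmul_pure mulrA.
Qed.

Lemma lmul0 t : lmul 0 t = 0.
Proof. by rewrite -(scale0r (0 : B)) lmulZ scale0r. Qed.

Lemma lmul1 t : lmul 1 t = t.
Proof.
elim/tens_ind: t => [|t u IHt IHu|l t IHt|c v].
- by rewrite lmul0t.
- by rewrite lmulDt IHt IHu.
- by rewrite lmulZt IHt.
- by rewrite lmul_pure mul1r.
Qed.

Lemma tens_iact_mul x y t :
  lmul (I x) (lmul (I y) t) = if x == y then lmul (I x) t else 0.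
Proof. by rewrite -lmulM idem_mul; case: eqP => // _; exact: lmul0. Qed.

Lemma tens_iact_sum t : \sum_x lmul (I x) t = t.
Proof.
rewrite -[RHS]lmul1 -sum_idemE.
by elim/big_rec2: _ => [|x a b _ ->]; rewrite ?lmul0 ?lmulD.
Qed.

(** [B (x)_(I_n) N] with its left [I_n]-action. *)
Definition tensor : imod := Imod tens_iact_mul tens_iact_sum.

End TensorProduct.

Arguments lmul {N} a.

Section IdTensor.
Variables (N N' : imod) (f : ihom N N').
Definition idtens_phi (a : B) (v : N) : tensor N' := pure a (f v).
Fact idtensDl a b v : idtens_phi (a + b) v = idtens_phi a v + idtens_phi b v.
Proof. exact: pureDl. Qed.
Fact idtensDr a v w : idtens_phi a (v + w) = idtens_phi a v + idtens_phi a w.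
Proof. by rewrite /idtens_phi linearD pureDr. Qed.
Fact idtensZl k a v : idtens_phi (k *: a) v = k *: idtens_phi a v.
Proof. exact: pureZl. Qed.
Fact idtensZr k a v : idtens_phi a (k *: v) = k *: idtens_phi a v.
Proof. by rewrite /idtens_phi linearZZ pureZr. Qed.
Fact idtensI a x v : idtens_phi (a * I x) v = idtens_phi a (iact x v).
Proof. by rewrite /idtens_phi pureI ihomI. Qed.
Definition idtens : {linear tensor N -> tensor N'} :=
  lift idtensDl idtensDr idtensZl idtensZr idtensI.
Lemma idtens_pure a v : idtens (pure a v) = pure a (f v).
Proof. exact: lift_pure. Qed.
End IdTensor.

(** [mu_tens] is [mu (x) id], where [mu] is the product of [B]. *)
Section MuTensor.
Variable N : imod.
Definition mu_phi (a : B) (t : tensor N) : tensor N := lmul a t.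
Fact muDl a b t : mu_phi (a + b) t = mu_phi a t + mu_phi b t.
Proof. exact: lmulD. Qed.
Fact muDr a t u : mu_phi a (t + u) = mu_phi a t + mu_phi a u.
Proof. exact: linearD. Qed.
Fact muZl k a t : mu_phi (k *: a) t = k *: mu_phi a t.
Proof. exact: lmulZ. Qed.
Fact muZr k a t : mu_phi a (k *: t) = k *: mu_phi a t.
Proof. exact: linearZZ. Qed.
Fact muI a x t : mu_phi (a * I x) t = mu_phi a (iact x t).
Proof. exact: lmulM. Qed.
Definition mu_tens : {linear tensor (tensor N) -> tensor N} :=
  lift muDl muDr muZl muZr muI.
Lemma mu_tens_pure a b v : mu_tens (pure a (pure b v : tensor N)) = pure (a * b) v.
Proof. by rewrite /mu_tens lift_pure; exact: lmul_pure. Qed.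
End MuTensor.

End Tensor.

Arguments iact {n K i} x : rename.
Arguments lmul {n K N} a.

Section FreeModule.
Variables (n : nat) (K : fieldType) (S : finType) (bd : S -> cleaved_link n).
Local Notation B := (BGamma n K).

Definition free_fun : Type := {ffun S -> K^o}.
HB.instance Definition _ := GRing.Lmodule.on free_fun.

Definition free_act (L : cleaved_link n) (v : free_fun) : free_fun :=
  [ffun x => if bd x == L then v x else 0].

Lemma free_act_linear L : linear (free_act L).
Proof.
move=> k u v; apply/ffunP=> x; rewrite !ffunE.
by case: eqP => _ //; rewrite scaler0 addr0.
Qed.
HB.instance Definition _ L :=
  GRing.isLinear.Build K free_fun free_fun _ (free_act L) (free_act_linear L).

Lemma free_act_mul L L' v :
  free_act L (free_act L' v) = if L == L' then free_act L v else 0.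
Proof.
case: (L =P L') => [<-|LL']; apply/ffunP=> x; rewrite !ffunE.
  by case: eqP.
by case: eqP => // ->; case: eqP.
Qed.

Lemma free_act_sum v : \sum_L free_act L v = v.
Proof.
apply/ffunP=> x.
have sumE r : (\sum_(L <- r) free_act L v) x = \sum_(L <- r) free_act L v x.
  elim: r => [|L r IHr]; first by rewrite !big_nil ffunE.
  by rewrite !big_cons ffunE IHr.
rewrite sumE (eq_bigr (fun L => if bd x == L then v x else 0)).
  by rewrite -big_mkcond; apply: (big_pred1 (bd x)) => L; exact: eq_sym.
by move=> L _; exact: ffunE.
Qed.

(** The vector space with basis [S], on which [I_L] acts as the projection to
    the span of the basis elements with boundary [L]. *)
Definition free_imod : imod n K :=
  @Imod n K free_fun (fun L => free_act L) free_act_mul free_act_sum.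

Definition basis (x : S) : free_imod := [ffun y => (y == x)%:R] : free_fun.

Local Notation "a '(x)' y" := (@pure n K free_imod a (basis y))
  (at level 40, format "a  '(x)'  y").

Section LinearExtension.
Variable d : S -> tensor free_imod.
Definition extend_fun (v : free_imod) : tensor free_imod :=
  \sum_(x : S) ((v : free_fun) x : K) *: d x.
Lemma extend_linear : linear extend_fun.
Proof.
move=> k u v; rewrite /extend_fun scaler_sumr -big_split; apply: eq_bigr => x _.
by rewrite !ffunE scalerDl scalerA.
Qed.
HB.instance Definition _ :=
  GRing.isLinear.Build K free_imod (tensor free_imod) _ extend_fun extend_linear.
Hypothesis dI : forall L x, iact L (d x) = if bd x == L then d x else 0.
Lemma extendI L v : extend_fun (iact L v) = iact L (extend_fun v).
Proof.
rewrite /extend_fun linear_sum; apply: eq_bigr => x _.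
rewrite linearZZ dI ffunE.
by case: eqP => _; rewrite ?scale0r ?scaler0.
Qed.
(** The [K]-linear extension of [d], which is [I_n]-linear. *)
Definition extend : ihom free_imod (tensor free_imod) :=
  @Ihom n K free_imod (tensor free_imod) extend_fun extendI.
End LinearExtension.

Lemma homogeneousP (L : cleaved_link n) x (a : B) y :
  idem K (bd x) * a = a ->
  iact L (a (x) y : tensor free_imod) = if bd x == L then a (x) y else 0.
Proof.
move=> <-; rewrite [LHS]lmul_pure mulrA idem_mul eq_sym.
by case: eqP => [<-//|_]; rewrite mul0r pure0l.
Qed.

Lemma homogeneous_sum (L : cleaved_link n) x (J : finType) (P : pred J)
    (F : J -> tensor free_imod) :
  (forall j, P j -> iact L (F j) = if bd x == L then F j else 0) ->
  iact L (\sum_(j | P j) F j) =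
  if bd x == L then \sum_(j | P j) F j else 0.
Proof.
move=> FP; rewrite linear_sum (eq_bigr _ FP); case: eqP => // _.
exact: big1.
Qed.

Lemma homogeneousD (L : cleaved_link n) x (t u : tensor free_imod) :
  iact L t = (if bd x == L then t else 0) ->
  iact L u = (if bd x == L then u else 0) ->
  iact L (t + u) = if bd x == L then t + u else 0.
Proof. by move=> tP uP; rewrite linearD tP uP; case: eqP; rewrite ?addr0. Qed.

End FreeModule.

(** The diagram is cut by vertical lines into slices, listed from the axis
    rightwards; the strands meeting a vertical line are numbered from below,
    starting with 0.
    [Cross i o]: the strands [i] and [i+1] cross, the strand from [i] to [i+1]
    being the over-strand iff [o].
    [Cup i]: two strands, which become [i] and [i+1], are born (a local minimum
    of the first coordinate).
    [Cap i]: the strands [i] and [i+1] are joined and die. *)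
Variant slice : Type :=
| Cross of nat & bool
| Cup of nat
| Cap of nat.

Definition slice_fits (k : nat) (sl : slice) : bool :=
  match sl with
  | Cross i _ | Cap i => (i.+1 < k)%N
  | Cup i => (i <= k)%N
  end.

Definition out_width (k : nat) (sl : slice) : nat :=
  match sl with Cross _ _ => k | Cup _ => k.+2 | Cap _ => k.-2 end.

(** Number of strands meeting the [j]-th vertical line of a diagram [w] with
    [k] strands at the axis. *)
Fixpoint width (k : nat) (w : seq slice) (j : nat) {struct j} : nat :=
  if j is j'.+1 then
    if w is sl :: w' then width (out_width k sl) w' j' else k
  else k.

Fixpoint closes (k : nat) (w : seq slice) : bool :=
  if w is sl :: w' then slice_fits k sl && closes (out_width k sl) w'
  else k == 0%N.

(** What happens at a crossing: the four ends are left disjoint ([Cut]), joined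
    by horizontal arcs ([Flat]), by two turn-backs ([Turn]), or along the
    strands of the tangle ([Pass]). *)
Variant crossing_mode := Cut | Flat | Turn | Pass.

Definition skip2 (i a : nat) : nat := if (a < i)%N then a else a.+2.

(** [(false, a)] is the [a]-th point on the left boundary of the slice, and
    [(true, a)] is the [a]-th point on its right boundary. *)
Definition half_joined (md : crossing_mode) (sl : slice) (e f : bool * nat) :=
  match sl, e, f with
  | Cup i, (false, a), (true, b) => b == skip2 i a
  | Cup i, (true, a), (true, b) => (a == i) && (b == i.+1)
  | Cap i, (false, a), (true, b) => a == skip2 i b
  | Cap i, (false, a), (false, b) => (a == i) && (b == i.+1)
  | Cross i _, (false, a), (true, b) =>
      if (a == i) || (a == i.+1) then
        match md with
        | Flat => b == a
        | Pass => ((b == i) || (b == i.+1)) && (b != a)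
        | Cut | Turn => false
        end
      else b == a
  | Cross i _, (s, a), (t, b) =>
      if md is Turn then [&& s == t, a == i & b == i.+1] else false
  | _, _, _ => false
  end.

Definition joined md sl e f : bool :=
  half_joined md sl e f || half_joined md sl f e.

Section Diagram.
Variables (n : nat) (w : seq slice).

(** The intersection points of the diagram with the vertical lines. *)
Definition points : finType := {j : 'I_(size w).+1 & 'I_(width n.*2 w j)}.

Definition line (u : points) : nat := tag u.
Definition height (u : points) : nat := tagged u.

Definition axis (p : pt n) : points :=
  @Tagged 'I_(size w).+1 ord0 (fun j => 'I_(width n.*2 w j)) p.

Definition slice_at (j : 'I_(size w)) : slice := nth (Cup 0) w j.

(** Adjacency of points in the diagram, with [md] telling what happens at the
    crossings. *)
Definition adjacent (md : 'I_(size w) -> crossing_mode) : rel points :=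
  [rel u v | [exists j : 'I_(size w), exists s : bool, exists t : bool,
    [&& line u == (s + j)%N, line v == (t + j)%N
      & joined (md j) (slice_at j) (s, height u) (t, height v)]]].

(** [true] means that the strand is oriented to the right; the direction is
    kept by strands traversing a slice, and is reversed by cups and caps. *)
Definition is_orientation (o : {ffun points -> bool}) : bool :=
  [forall u, forall v, adjacent (fun=> Pass) u v ==>
    ((o u == o v) == (line u != line v))].

End Diagram.

(** Up to planar isotopy, every diagram of an oriented right tangle with
    boundary [P_n] is of this form. The orientation only matters for the
    gradings. *)
Record right_tangle n := RightTangle {
  word :> seq slice;
  tangle_closes : closes n.*2 word;
  orientation : {ffun points n word -> bool};
  orientationP : is_orientation orientation }.

Section States.
Variables (n : nat) (T : right_tangle n).
Local Notation V := (points n T).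
Local Notation crossing_index := 'I_(size T).

Definition is_crossing (c : crossing_index) : bool :=
  if slice_at c is Cross _ _ then true else false.

Definition cut_rel : rel V := adjacent (fun=> Cut).
Definition is_tangle_arc (f : {set V}) : bool :=
  [exists u, f == [set v | connect cut_rel u v]].
Definition tangle_arc : finType := {f : {set V} | is_tangle_arc f}.

(** A resolution is the set of the crossings that are 1-resolved. The
    0-resolution joins the two regions swept by the over-strand when it is
    turned counterclockwise, so that it consists of two turn-backs when the
    over-strand is the ascending one. *)
Definition resolution_mode (rho : {set crossing_index}) (c : crossing_index) :=
  if slice_at c is Cross _ o then
    if o (+) (c \in rho) then Turn else Flat
  else Flat.

Definition resolved (rho : {set crossing_index}) : rel V :=
  adjacent (resolution_mode rho).

(** The left matching [m] glued to the resolution [rho]. *)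
Definition glued (m : matching n) (rho : {set crossing_index}) : rel V :=
  [rel u v | resolved rho u v ||
    [exists p, (u == axis T p) && (v == axis T (m p))]].

(** A state consists of a left matching, a resolution, and a decoration, which
    is a function on the points that is constant along the circles. The right
    matching induced by the resolution is stored as well: it exists because the
    diagram is planar, and it is unique. *)
Definition is_state
    (x : link n * {set crossing_index} * {ffun V -> bool}) : bool :=
  let: (L, rho, s) := x in
  [&& rho \subset is_crossing,
      [forall p, forall q, connect (resolved rho) (axis T p) (axis T q)
                           == (q \in arc L.2 p)],
      [forall u, forall v, glued L.1 rho u v ==> (s u == s v)]
    & [forall p, is_marked p ==> ~~ s (axis T p)]].

Record state := State {
  st_val :> link n * {set crossing_index} * {ffun V -> bool};
  st_valP : is_state st_val }.

HB.instance Definition _ := [isSub for st_val].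
HB.instance Definition _ := [Finite of state by <:].

Definition st_link (x : state) : link n := (st_val x).1.1.
Definition st_res (x : state) : {set crossing_index} := (st_val x).1.2.
Definition st_dec (x : state) : {ffun V -> bool} := (st_val x).2.
Definition st_rel (x : state) : rel V := glued (st_link x).1 (st_res x).

Definition st_circles (x : state) : {set {set V}} :=
  [set [set v | connect (st_rel x) u v] | u : V].
Definition on_axis (C : {set V}) : {set pt n} := [set p | axis T p \in C].
Definition is_free (C : {set V}) : bool := on_axis C == set0.

Lemma boundary_subproof (x : state) :
  is_decoration (st_link x, [ffun p => st_dec x (axis T p)]).
Proof.
case: x => [[[L rho] s] /= xP]; have := xP => /and4P[_ /forallP rhoP sP mP].
have stepP u v : glued L.1 rho u v -> s u = s v.
  by move=> uv; apply/eqP; move/forallP/(_ u)/forallP/(_ v)/implyP: sP; apply.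
have conP u v : connect (resolved rho) u v -> s u = s v.
  case/connectP=> q; elim: q u => [|a q IHq] u /=; first by move=> _ ->.
  case/andP=> ua qP vE; rewrite (stepP u a); last by rewrite /glued /= ua.
  exact: IHq.
apply/andP; split; apply/forallP => p; last first.
  by rewrite /= ffunE; exact: (forallP mP).
rewrite /= !ffunE; apply/andP; split; apply/eqP/esym.
  apply: stepP; rewrite /glued /=; apply/orP; right.
  by apply/existsP; exists p; rewrite !eqxx.
apply: conP; have /forallP/(_ (L.2 p))/eqP -> := rhoP p.
by rewrite !inE eqxx orbT.
Qed.

(** The decorated cleaved link obtained by deleting the free circles. *)
Definition boundary (x : state) : cleaved_link n :=
  CleavedLink (boundary_subproof x).

(** The four ends at the crossing [c]. *)
Definition crossing_ends (c : crossing_index) : {set V} :=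
  if slice_at c is Cross i _ then
    [set u : V | ((line u == c) || (line u == c.+1)) &&
                 ((height u == i) || (height u == i.+1))]
  else set0.

(** [y] is obtained from [x] by surgery along the active resolution bridge at
    the crossing [c]. *)
Definition res_step (c : crossing_index) (x y : state) : bool :=
  [&& is_crossing c, c \notin st_res x, st_res y == c |: st_res x,
      (st_link y).1 == (st_link x).1
    & khovanov (st_rel x) (st_rel y) (crossing_ends c) (st_dec x) (st_dec y)].

(** [y] is obtained from [x] by surgery along the left bridge [A]. *)
Definition left_step (A : {set {set pt n}}) (x y : state) : bool :=
  [&& is_bridge (st_link x).1 A, is_surgery (st_link x).1 A (st_link y).1,
      st_res y == st_res x
    & khovanov (st_rel x) (st_rel y) [set axis T p | p in cover A]
        (st_dec x) (st_dec y)].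

(** [C] is a + circle of [x], and [y] is [x] with [C] redecorated by -. *)
Definition dec_step (C : {set V}) (x y : state) : bool :=
  [&& C \in st_circles x, [forall u in C, st_dec x u],
      st_link y == st_link x, st_res y == st_res x
    & st_dec y == [ffun u => st_dec x u && (u \notin C)]].

(** The bridge of the boundary of [x] given by the active resolution bridge at
    [c]: the arcs of the right matching passing through the crossing. *)
Definition res_bridge (c : crossing_index) (x : state) : {set {set pt n}} :=
  [set arc (st_link x).2 p | p : pt n &
    [exists u in crossing_ends c, connect (resolved (st_res x)) (axis T p) u]].

Section StructureMaps.
Variables (K : fieldType) (X : tangle_arc -> K).
Local Notation B := (BGamma n K).

(** The sum of the variables of the arcs lying on [C]. *)
Definition weight (C : {set V}) : K :=
  \sum_(f : tangle_arc | val f \subset C) X f.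

(** The algebra element of the term of [deltaT] for the crossing [c]. *)
Definition res_elt (c : crossing_index) (x y : state) : B :=
  if (st_link y).2 != (st_link x).2 then
    elt K (Bri Right (res_bridge c x) (boundary x) (boundary y))
  else if boundary y == boundary x then idem K (boundary x)
  else elt K (Dec Right (boundary x)
    [set p | dec_of (boundary x) p && ~~ dec_of (boundary y) p] (boundary y)).

Definition Dmod : imod n K := free_imod K boundary.

Local Notation "a '(x)' y" := (@pure n K Dmod a (basis K boundary y))
  (at level 40, format "a  '(x)'  y").

Definition deltaT_basis (x : state) : tensor Dmod :=
  \sum_(c : crossing_index) \sum_(y | res_step c x y) res_elt c x y (x) y
  + \sum_(A : {set {set pt n}}) \sum_(y | left_step A x y)
      elt K (Bri Left A (boundary x) (boundary y)) (x) y
  + \sum_(C : {set V} | ~~ is_free C) \sum_(y | dec_step C x y)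
      elt K (Dec Left (boundary x) (on_axis C) (boundary y)) (x) y.

Definition deltaV_basis (x : state) : tensor Dmod :=
  \sum_(C : {set V} | is_free C) \sum_(y | dec_step C x y)
      (weight C *: idem K (boundary x)) (x) y
  + \sum_(C : {set V} | ~~ is_free C) \sum_(y | dec_step C x y)
      (weight C *: elt K (Dec Right (boundary x) (on_axis C) (boundary y))) (x) y.

Lemma res_elt_source c x y : idem K (boundary x) * res_elt c x y = res_elt c x y.
Proof.
rewrite /res_elt; case: ifP => _; first exact: idem_source K (Bri _ _ _ _).
case: ifP => _; first by rewrite idem_mul eqxx.
exact: idem_source K (Dec _ _ _ _).
Qed.

Lemma deltaT_homogeneous L x :
  iact L (deltaT_basis x) = if boundary x == L then deltaT_basis x else 0.
Proof.
apply: homogeneousD; [apply: homogeneousD|];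
  apply: homogeneous_sum => ? _; apply: homogeneous_sum => ? _;
  apply: homogeneousP.
- exact: res_elt_source.
- exact: idem_source K (Bri _ _ _ _).
- exact: idem_source K (Dec _ _ _ _).
Qed.

Lemma deltaV_homogeneous L x :
  iact L (deltaV_basis x) = if boundary x == L then deltaV_basis x else 0.
Proof.
apply: homogeneousD;
  apply: homogeneous_sum => ? _; apply: homogeneous_sum => ? _;
  apply: homogeneousP; rewrite -presented_scaleAr.
  by rewrite idem_mul eqxx.
by congr (_ *: _); exact: idem_source K (Dec _ _ _ _).
Qed.

Definition deltaT_over : ihom Dmod (tensor Dmod) := extend deltaT_homogeneous.
Definition deltaV_over : ihom Dmod (tensor Dmod) := extend deltaV_homogeneous.

End StructureMaps.

Definition coef_ring : idomainType := {mpoly 'F_2[#|tangle_arc|]}.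
Definition coef_field : fieldType := {fraction coef_ring}.
Definition arc_variable (f : tangle_arc) : coef_field :=
  tofrac ('X_(enum_rank f) : {mpoly 'F_2[#|tangle_arc|]}).

Definition D : imod n coef_field := Dmod coef_field.
Definition deltaT : ihom D (tensor D) := deltaT_over coef_field.
Definition deltaV : ihom D (tensor D) := deltaV_over arc_variable.

End States.

(* Main.v *)
From HB Require Import structures.
From mathcomp Require Import mpoly.
From mathcomp Require Import all_boot all_algebra fraction.
From mathcomp Require Import boolp.
Require Import Defs.

Set Implicit Arguments.
Unset Strict Implicit.
Unset Printing Implicit Defensive.

Import GRing.Theory.
Local Open Scope ring_scope.

(** Both composites are sums over pairs of states [x], [z] and over the states
    [y] in between, so it suffices to fix [x], [z] and one kind of step of
    [deltaT] - a crossing, a left bridge, or a left decoration - and to compare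
    the products in which a vertical step comes before and after that step.

    A left decoration commutes with a vertical step by [R1]. A crossing and a left
    bridge are both surgeries on the circles of the state: the adjacency relations
    [e], [e'] before and after differ only between the points of the set [F] of
    ends that are cut and reconnected. Hence the set [U] of points whose circle is
    touched by the surgery is the same for [e] and [e'], and the circles outside
    [U] are common to both.

    If the vertical step changes a circle outside [U], then the two orders are in
    bijection and the products agree, by [R2], by [R1], or because the circle is
    free. If it changes a touched circle, the point is that the possible
    intermediate states do not depend on this circle: the Khovanov rules allow to
    go from [x] to [z] through some touched circle, in some order, if and only if
    the surgery is a merge or a division, all of [U] is decorated by + in [x] and
    by - in [z], and the decorations agree outside [U] ([lower_khovanov],
    [khovanov_lower] and their duals); then every touched circle, of [e] or of
    [e'], is possible. All the products have the same value [g], by [R9_merge] and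
    [R9_divide] if the surgery is visible in the boundary as a bridge. So the
    products in one order add up to [g] times the total weight of the circles of
    [e] in [U], and those in the other order to [g] times the total weight of the
    circles of [e'] in [U]; both weights are that of [U] ([weight_touched]). The
    two composites are therefore equal, and their sum vanishes in characteristic 2.

    For a crossing there are two cases. If the surgery changes the right matching,
    then all four ends of the crossing are joined to the axis
    ([right_matching_changed]), so that all the touched circles are cleaved and the
    surgery is visible in the boundary. Otherwise the boundary has at most one
    touched circle ([touched_axis_connect]), and all the products are equal to the
    element of the total change of its decoration. *)

(** * Components of a symmetric relation *)

Section Components.
Variable V : finType.
Implicit Types (e : rel V) (D : {set V}) (s : V -> bool).

Definition component e u : {set V} := [set v | connect e u v].
Definition components e : {set {set V}} := [set component e u | u : V].

Lemma component_refl e u : u \in component e u.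
Proof. by rewrite inE connect0. Qed.

Lemma mem_components e u : component e u \in components e.
Proof. exact: imset_f. Qed.

Lemma component_eq e D u :
  symmetric e -> D \in components e -> u \in D -> D = component e u.
Proof.
move=> /sym_connect_sym eC /imsetP[w _ ->]; rewrite inE => wu.
by apply/setP=> v; rewrite !inE (same_connect eC wu).
Qed.

Lemma mem_component e D u v :
  symmetric e -> D \in components e -> u \in D -> (v \in D) = connect e u v.
Proof. by move=> eS De uD; rewrite (component_eq eS De uD) inE. Qed.

Lemma component_closed e D u v :
  symmetric e -> D \in components e -> e u v -> (u \in D) = (v \in D).
Proof.
move=> eS De uv; apply/idP/idP=> iD; rewrite (mem_component _ eS De iD);
  by apply: connect1; rewrite // eS.
Qed.

Definition constant_on e s := forall u v, e u v -> s u = s v.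

Lemma constant_connect e s u v : constant_on e s -> connect e u v -> s u = s v.
Proof.
move=> sc /connectP[p]; elim: p u => [|a p IHp] u /=; first by move=> _ ->.
by case/andP=> /sc -> ap /IHp; apply.
Qed.

End Components.

(** * Surgery and the Khovanov sign rules *)

Section Surgery.
Variables (V : finType) (F : {set V}).
Implicit Types (e : rel V) (D : {set V}) (s t : V -> bool).

(** A surgery with ends [F] only reconnects points of [F] with each other. *)
Definition agree_off e e' :=
  forall u v, ~~ ((u \in F) && (v \in F)) -> e u v = e' u v.

Lemma agree_offC e e' : agree_off e e' -> agree_off e' e.
Proof. by move=> ee' u v uv; rewrite ee'. Qed.

Definition touched e : {set V} := [set v | [exists u in F, connect e u v]].

Lemma touchedP e v :
  reflect (exists2 u, u \in F & connect e u v) (v \in touched e).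
Proof. by rewrite inE; apply: exists_inP. Qed.

Lemma touched_connect e u v : connect e u v -> u \in touched e -> v \in touched e.
Proof.
move=> uv /touchedP[f fF fu]; apply/touchedP; exists f => //.
exact: connect_trans uv.
Qed.

Lemma touched_F e u : u \in F -> u \in touched e.
Proof. by move=> uF; apply/touchedP; exists u. Qed.

Lemma component_touched e D u :
  symmetric e -> D \in components e -> ~~ [disjoint D & F] -> u \in D ->
  u \in touched e.
Proof.
move=> eS De /pred0Pn[w /andP[wD wF]] uD; apply/touchedP; exists w => //.
by rewrite -(mem_component _ eS De).
Qed.

Lemma component_untouched e D u :
  symmetric e -> D \in components e -> [disjoint D & F] -> u \in D ->
  u \notin touched e.
Proof.
move=> eS De DF uD; apply/touchedP=> -[w wF wu].
have wD : w \in D by rewrite (mem_component _ eS De uD) (sym_connect_sym eS).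
by move/pred0P/(_ w): DF; rewrite /= wD wF.
Qed.

Lemma connect_untouched e e' u v :
  symmetric e -> agree_off e e' -> u \notin touched e ->
  connect e u v -> connect e' u v.
Proof.
move=> eS ee' + /connectP[p].
elim: p u => [|a p IHp] u uU /=; first by move=> _ ->.
case/andP=> ua ap vE; apply: (@connect_trans _ _ a).
  apply: connect1; rewrite -ee' //; apply/negP=> /andP[uF _].
  by case/negP: uU; apply: touched_F.
apply: IHp => //; apply: contra uU; apply: touched_connect.
by apply: connect1; rewrite eS.
Qed.

(** A path of [e] that leads to [F] is also a path of [e'] until it meets [F] for
    the first time. *)
Lemma touched_agree_sub e e' :
  symmetric e -> symmetric e' -> agree_off e e' -> touched e \subset touched e'.
Proof.
move=> eS eS' ee'; apply/subsetP=> v /touchedP[f fF].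
rewrite (sym_connect_sym eS) => /connectP[p].
elim: p v => [|a p IHp] v /=; first by move=> _ <-; apply: touched_F.
case/andP=> va ap fE; case: (boolP (v \in F)) => [|vF]; first exact: touched_F.
have := IHp a ap fE; apply: touched_connect; apply: connect1.
by rewrite eS' -ee' // negb_and vF.
Qed.

Lemma touched_agree e e' :
  symmetric e -> symmetric e' -> agree_off e e' -> touched e = touched e'.
Proof.
move=> eS eS' ee'; apply/eqP; rewrite eqEsubset !touched_agree_sub //.
exact: agree_offC.
Qed.

Lemma untouched_component e e' D :
  symmetric e -> symmetric e' -> agree_off e e' -> [disjoint D & F] ->
  D \in components e -> D \in components e'.
Proof.
move=> eS eS' ee' DF De; case/imsetP: (De) => u _ DE.
have uD : u \in D by rewrite DE component_refl.
have uU := component_untouched eS De DF uD.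
suff -> : D = component e' u by apply: mem_components.
rewrite DE; apply/setP=> v; rewrite !inE; apply/idP/idP.
  exact: connect_untouched.
apply: connect_untouched (agree_offC ee') _ => //.
by rewrite -(touched_agree eS eS').
Qed.

Lemma on_oneP e :
  reflect {in F &, forall u v, connect e u v} (on_one_circle e F).
Proof.
apply: (iffP forall_inP) => [H u v uF vF|H u uF].
  exact: (forall_inP (H u uF)).
by apply/forall_inP => v vF; apply: H.
Qed.

Lemma on_twoP e u v :
  reflect (~~ connect e u v /\
           forall w, w \in F -> connect e u w || connect e v w)
    (on_two_circles e F u v).
Proof.
by apply: (iffP andP) => -[uv /forall_inP H]; split=> //; apply/forall_inP.
Qed.

Lemma touched_one e D :
  symmetric e -> on_one_circle e F -> D \in components e ->
  ~~ [disjoint D & F] -> D = touched e.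
Proof.
move=> eS /on_oneP e1 De DF; apply/setP=> v; apply/idP/idP.
  exact: component_touched.
case/touchedP=> u uF uv; case/pred0Pn: DF => w /andP[wD wF].
by rewrite (mem_component _ eS De wD); apply: connect_trans uv; apply: e1.
Qed.

Lemma touched_two e u v :
  u \in F -> v \in F -> on_two_circles e F u v ->
  touched e = component e u :|: component e v.
Proof.
move=> uF vF /on_twoP[_ e2]; apply/setP=> w; rewrite in_setU !inE.
apply/exists_inP/idP=> [[f fF fw]|/orP[]]; last 2 first.
- by exists u.
- by exists v.
by case/orP: (e2 f fF) => uf; rewrite (connect_trans uf fw) ?orbT.
Qed.

(** By symmetry, the chosen component meeting [F] may be taken to be the first of
    the two. *)
Lemma on_two_choose e D u v :
  symmetric e -> u \in F -> v \in F -> on_two_circles e F u v ->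
  D \in components e -> ~~ [disjoint D & F] ->
  exists u1 v1, [/\ u1 \in F, v1 \in F, on_two_circles e F u1 v1,
    D = component e u1 & (u1, v1) = (u, v) \/ (u1, v1) = (v, u)].
Proof.
move=> eS uF vF uv De /pred0Pn[w /andP[wD wF]].
have [nuv e2] := on_twoP _ _ _ uv; have eC := sym_connect_sym eS.
case/orP: (e2 w wF) => cw; [exists u, v|exists v, u]; split=> //.
- by rewrite (component_eq (u := u) eS De) // (mem_component _ eS De wD) eC.
- by left.
- by apply/on_twoP; rewrite eC; split=> // f /e2; rewrite orbC.
- by rewrite (component_eq (u := v) eS De) // (mem_component _ eS De wD) eC.
- by right.
Qed.

Definition merges e e' s s' :=
  exists u v, [/\ u \in F, v \in F, on_two_circles e F u v, on_one_circle e' F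
                & merge_rule (s u) (s v) (s' u)].

(** Reversing time and exchanging the two signs turns the division rule into
    the merging rule, so that one half of the rules suffices. *)
Lemma khovanovP e e' s s' :
  reflect ((forall v, v \notin touched e -> s' v = s v) /\
    (merges e e' s s' \/ merges e' e (negb \o s') (negb \o s)))
    (khovanov e e' F s s').
Proof.
have uE v : (v \notin touched e) = [forall u in F, ~~ connect e u v].
  by rewrite inE negb_exists_in.
apply: (iffP andP) => -[H1 H2]; split.
- by move=> v; rewrite uE => vU; apply/eqP; apply: (implyP (forallP H1 v)).
- case/orP: H2 => /exists_inP[u uF /exists_inP[v vF /and3P[A1 A2 A3]]].
    by left; exists u, v.
  right; exists u, v; split=> //=.
  by move: A3; case: (s u) (s' u) (s' v) => [] [] [].
- by apply/forallP=> v; rewrite -uE; apply/implyP=> /H1 ->.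
- case: H2 => -[u [v [uF vF A1 A2 A3]]]; apply/orP; [left|right];
    apply/exists_inP; exists u => //; apply/exists_inP; exists v => //;
    apply/and3P; split=> //.
  by move: A3 => /=; case: (s u) (s' u) (s' v) => [] [] [].
Qed.

Lemma eq_merges e e' s s' t t' :
  s =1 t -> s' =1 t' -> merges e e' s s' -> merges e e' t t'.
Proof. by move=> st st' [u [v]]; rewrite !st st' => H; exists u, v. Qed.

Lemma khovanov_dual e e' s s' :
  symmetric e -> symmetric e' -> agree_off e e' ->
  khovanov e e' F s s' -> khovanov e' e F (negb \o s') (negb \o s).
Proof.
move=> eS eS' ee' /khovanovP[H1 H2]; apply/khovanovP; split.
  by move=> v; rewrite -(touched_agree eS eS' ee') => /H1 /= ->.
case: H2 => H; [right|left] => //.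
by apply: eq_merges H => v /=; rewrite negbK.
Qed.

Lemma eq_khovanov e e' s s' t t' :
  s =1 t -> s' =1 t' -> khovanov e e' F s s' -> khovanov e e' F t t'.
Proof.
move=> st st' /khovanovP[H1 H2]; apply/khovanovP; split.
  by move=> v /H1; rewrite st st'.
by case: H2 => H; [left|right]; apply: eq_merges H => v //=; rewrite ?st ?st'.
Qed.

Lemma khovanov_off D e e' s s' t t' :
  [disjoint D & F] -> (forall v, v \notin D -> s v = t v) ->
  (forall v, v \notin D -> s' v = t' v) -> (forall v, v \in D -> t' v = t v) ->
  khovanov e e' F s s' -> khovanov e e' F t t'.
Proof.
move=> DF st st' tt /khovanovP[H1 H2]; apply/khovanovP; split.
  move=> v vU; case: (boolP (v \in D)) => [/tt //|vD].
  by rewrite -st // -st' //; apply: H1.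
have FD u : u \in F -> u \notin D.
  by move=> uF; rewrite (disjointFl DF).
by case: H2 => -[u [v [uF vF A1 A2 A3]]]; [left|right]; exists u, v; split=> //;
  move: A3; rewrite /= !(st, st') ?FD.
Qed.

Definition reconnects e e' := exists u v,
  [/\ u \in F, v \in F, on_two_circles e F u v & on_one_circle e' F].

(** The pairs of decorations that can be joined by the surgery together with the
    change of sign of one component touched by it. This condition mentions
    neither the component nor the order of the two moves, which is what makes all
    the choices possible as soon as one of them is. *)
Definition lowers e e' s s' :=
  [/\ forall v, v \in touched e -> s v && ~~ s' v,
      forall v, v \notin touched e -> s' v = s v
    & reconnects e e' \/ reconnects e' e].

Definition lower D s : V -> bool := fun v => s v && (v \notin D).
Definition raise D s : V -> bool := fun v => s v || (v \in D).

(** When two components merge, one of them is already -, so the rule leaves only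
    +- |-> -; when a component divides, only - |-> --. *)
Lemma lower_khovanov e e' s s' D :
  symmetric e -> symmetric e' -> agree_off e e' ->
  constant_on e s -> constant_on e' s' ->
  D \in components e -> ~~ [disjoint D & F] ->
  (forall v, v \in D -> s v) -> khovanov e e' F (lower D s) s' ->
  lowers e e' s s'.
Proof.
move=> eS eS' ee' sc sc' De DF Ds /khovanovP[H1 H2].
have UE := touched_agree eS eS' ee'.
have DU v : v \in D -> v \in touched e by exact: component_touched.
have off v : v \notin touched e -> s' v = s v.
  move=> vU; rewrite H1 // /lower andbC; case: (boolP (v \in D)) => // /DU.
  by rewrite (negPf vU).
case: H2 => -[u [v [uF vF A1 A2 A3]]]; last first.
  have DE := touched_one eS A2 De DF.
  have /andP[u'F v'F] : ~~ s' u && ~~ s' v.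
    move: A3; rewrite /= /lower DE touched_F // andbF /=.
    by case: (s' u) (s' v) => [] [].
  split=> //; last by right; exists u, v.
  move=> w wU; rewrite Ds ?DE //=; move: wU.
  rewrite UE (touched_two uF vF A1) !inE => /orP[] /(constant_connect sc') <- //.
have [u1 [v1 [u1F v1F B1 DE E]]] := on_two_choose eS uF vF A1 De DF.
have [nuv _] := on_twoP _ _ _ B1.
have s'E : s' u = s' u1.
  by apply: (constant_connect sc'); apply: (on_oneP _ A2).
have /andP[su1 /andP[sv1 su']] : [&& s u1, s v1 & ~~ s' u1].
  rewrite Ds ?DE ?component_refl //=.
  move: A3; rewrite s'E.
  have l1 : lower D s u1 = false by rewrite /lower DE component_refl andbF.
  have l2 : lower D s v1 = s v1 by rewrite /lower DE inE (negPf nuv) andbT.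
  by case: E => -[<- <-]; rewrite l1 l2; case: (s v1) (s' u1) => [] [].
split=> //; last by left; exists u, v.
move=> w wU; apply/andP; split; last first.
  have := wU; rewrite UE => /touchedP[f fF /(constant_connect sc') <-].
  by rewrite (constant_connect sc' (on_oneP _ A2 f u1 fF u1F)).
move: wU; rewrite (touched_two u1F v1F B1) !inE.
by case/orP=> /(constant_connect sc) <-.
Qed.

Lemma khovanov_lower e e' s s' D :
  symmetric e -> symmetric e' -> agree_off e e' ->
  D \in components e -> ~~ [disjoint D & F] ->
  lowers e e' s s' -> khovanov e e' F (lower D s) s'.
Proof.
move=> eS eS' ee' De DF [H1 H2 H3]; apply/khovanovP.
have DU v : v \in D -> v \in touched e by exact: component_touched.
split=> [v vU|].
  rewrite H2 // /lower; case: (boolP (v \in D)); rewrite ?andbT // => /DU.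
  by rewrite (negPf vU).
have F1 v : v \in F -> s v && ~~ s' v by move=> vF; apply/H1/touched_F.
case: H3 => -[u [v [uF vF A1 A2]]]; [left|right].
  have [u1 [v1 [u1F v1F B1 DE _]]] := on_two_choose eS uF vF A1 De DF.
  exists u1, v1; split=> //.
  have [nuv _] := on_twoP _ _ _ B1.
  rewrite /lower DE component_refl andbF inE nuv andbT.
  by have /andP[-> _] := F1 _ v1F; have /andP[_ /negPf ->] := F1 _ u1F.
exists u, v; split=> //=.
rewrite /lower (touched_one eS A2 De DF) (touched_F _ uF) andbF /=.
by have /andP[_ ->] := F1 _ uF; have /andP[_ ->] := F1 _ vF.
Qed.

Lemma lowers_dual e e' s s' :
  symmetric e -> symmetric e' -> agree_off e e' ->
  lowers e e' s s' -> lowers e' e (negb \o s') (negb \o s).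
Proof.
move=> eS eS' ee' [H1 H2 H3]; rewrite /lowers -(touched_agree eS eS' ee').
split=> [v /H1|v /H2 /= ->|] //=; first by rewrite negbK andbC.
by case: H3; [right|left].
Qed.

Lemma raise_khovanov e e' s s' D :
  symmetric e -> symmetric e' -> agree_off e e' ->
  constant_on e s -> constant_on e' s' ->
  D \in components e' -> ~~ [disjoint D & F] ->
  (forall v, v \in D -> ~~ s' v) -> khovanov e e' F s (raise D s') ->
  lowers e e' s s'.
Proof.
move=> eS eS' ee' sc sc' De DF Ds /(khovanov_dual eS eS' ee') H.
have ee'C := agree_offC ee'.
have : lowers e' e (negb \o s') (negb \o s).
  apply: (lower_khovanov (D := D)) => //.
  - by move=> u v /sc' /= ->.
  - by move=> u v /sc /= ->.
  - by apply: eq_khovanov H => v //; rewrite /lower /raise /= negb_or.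
move/(lowers_dual eS' eS ee'C) => [H1 H2 H3]; split=> //.
  by move=> v /H1 /=; rewrite !negbK.
by move=> v /H2 /=; rewrite !negbK.
Qed.

Lemma khovanov_raise e e' s s' D :
  symmetric e -> symmetric e' -> agree_off e e' ->
  D \in components e' -> ~~ [disjoint D & F] ->
  lowers e e' s s' -> khovanov e e' F s (raise D s').
Proof.
move=> eS eS' ee' De DF /(lowers_dual eS eS' ee') H.
have ee'C := agree_offC ee'.
have := khovanov_dual eS' eS ee'C (khovanov_lower eS' eS ee'C De DF H).
apply: eq_khovanov => v /=; rewrite /lower /raise /= ?negbK //.
by rewrite negb_and !negbK.
Qed.

End Surgery.

(** * Bridges of cleaved links *)

Section Links.
Variable n : nat.
Implicit Types (m : matching n) (L : link n) (x y z : cleaved_link n).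

Lemma partnerK m : involutive m.
Proof.
by move=> i; case: m => f /= /andP[/forallP/(_ i)/andP[_ /eqP]].
Qed.

Lemma partner_neq m i : m i != i.
Proof. by case: m => f /= /andP[/forallP/(_ i)/andP[mi _] _]. Qed.

Lemma link_rel_sym L : symmetric (link_rel L).
Proof.
suff H (m : matching n) i j : (j == m i) = (i == m j).
  by move=> i j; rewrite /link_rel /= !(H _ i j).
by apply/eqP/eqP=> ->; rewrite partnerK.
Qed.

Lemma bridge_cover m A i : is_bridge m A -> i \in cover A -> m i \in cover A.
Proof.
case/exists_inP=> a am /exists_inP[b bm /and3P[_ /eqP -> _]].
case/bigcupP=> c cA ic; apply/bigcupP; exists c => //.
have : c \in arcs m by move: cA; rewrite !inE => /orP[] /eqP ->.
case/imsetP=> j _ cE; move: ic; rewrite cE !inE => /orP[] /eqP ->.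
  by rewrite eqxx orbT.
by rewrite partnerK eqxx.
Qed.

Lemma bridge_agree_off b L L' A :
  is_bridge (side_of b L) A -> is_surgery (side_of b L) A (side_of b L') ->
  side_of (~~ b) L' = side_of (~~ b) L ->
  agree_off (cover A) (link_rel L) (link_rel L').
Proof.
move=> bA sA EL i j ij.
suff H : (j == side_of b L i) = (j == side_of b L' i).
  by case: b EL H {bA sA} => /= EL H; rewrite /link_rel /= EL H.
move/forallP/(_ i): sA; case: ifP => [iA|_ /eqP -> //].
rewrite in_setD => /andP[_ i'A]; rewrite iA /= in ij.
by apply/eqP/eqP=> jE; case/negP: ij; rewrite jE ?(bridge_cover bA).
Qed.

End Links.

(** * Products in the algebra *)

Section Relations.
Variables (n : nat) (K : fieldType).
Implicit Types (x y z : cleaved_link n) (b : bool) (C D : {set pt n}).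
Local Notation E := (@elt n K).
Local Notation I := (@idem n K).

Lemma elt_rel2 (g h g' h' : symbol n) :
  relation (EMul (sym K g) (sym K h)) (EMul (sym K g') (sym K h')) ->
  E g * E h = E g' * E h'.
Proof. by move/presented_rel; rewrite !class_ofM. Qed.

Lemma elt0 (g : symbol n) : ~~ denotes g -> E g = 0.
Proof. by move=> /negbTE g0; rewrite /elt /sym insubF. Qed.

Lemma idem_target (g : symbol n) : E g * I (target g) = E g.
Proof.
case: (boolP (denotes g)) => [g1|/elt0 ->]; last by rewrite mul0r.
by have /presented_rel := R0_target K g1; rewrite class_ofM.
Qed.

(** In a merge, [D] is one of the two parts of the touched region and [D'] is the
    whole of it; in a division, it is the other way round. *)
Lemma dec_bridge_touching b A x x' y z D D' :
  denotes (Dec Right x D x') -> denotes (Bri b A x' z) ->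
  denotes (Bri b A x y) -> denotes (Dec Right y D' z) ->
  ~~ [disjoint D & cover A] -> ~~ [disjoint D' & cover A] ->
  E (Bri b A x y) * E (Dec Right y D' z)
    = E (Dec Right x D x') * E (Bri b A x' z).
Proof.
move=> d1 d2 d3 d4 DA D'A.
have /and4P[bA sA /eqP oA /khovanovP[_ kA]] := d3.
have eS := link_rel_sym (link_of x); have eS' := link_rel_sym (link_of y).
have ee' := bridge_agree_off bA sA oA.
have UE := touched_agree eS eS' ee'.
have /and4P[De _ _ _] := d1; have /and4P[De' _ _ _] := d4.
apply/esym; case: kA => -[u [v [uA vA A1 A2 _]]].
  have [u1 [v1 [u1A v1A B1 DE _]]] := on_two_choose eS uA vA A1 De DA.
  have [nuv _] := on_twoP _ _ _ _ B1.
  apply/elt_rel2/(@R9_merge n K b A x x' y z D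
    (component (link_rel (link_of x)) v1)) => //.
  - apply/eqP=> DE'; have := component_refl (link_rel (link_of x)) v1.
    by rewrite -DE' DE inE (negPf nuv).
  - by rewrite (touched_one eS' A2 De' D'A) -UE DE (touched_two u1A v1A B1).
  - exact: mem_components.
have [u1 [v1 [u1A v1A B1 DE _]]] := on_two_choose eS' uA vA A1 De' D'A.
have [nuv _] := on_twoP _ _ _ _ B1.
apply/elt_rel2/(@R9_divide n K b A x x' y z D D'
  (component (link_rel (link_of y)) v1)) => //.
- apply/eqP=> DE'; have := component_refl (link_rel (link_of y)) v1.
  by rewrite -DE' DE inE (negPf nuv).
- by rewrite (touched_one eS A2 De DA) UE DE (touched_two u1A v1A B1).
- exact: mem_components.
Qed.

Lemma dec_bridge_disjoint b A x x' y z D :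
  denotes (Dec Right x D x') -> denotes (Bri b A x' z) ->
  denotes (Bri b A x y) -> denotes (Dec Right y D z) ->
  [disjoint D & cover A] ->
  E (Bri b A x y) * E (Dec Right y D z)
    = E (Dec Right x D x') * E (Bri b A x' z).
Proof.
by move=> d1 d2 d3 d4 DA; apply/elt_rel2/R2 => //; rewrite disjoint_sym.
Qed.

(** A free circle acts by an idempotent and a cleaved one by a decoration element.
    Only the two ends matter: this element covers both cases. *)
Definition redec x y : BGamma n K :=
  if x == y then I x
  else E (Dec Right x [set p | dec_of x p && ~~ dec_of y p] y).

Lemma redec_id x : redec x x = I x. Proof. by rewrite /redec eqxx. Qed.

Lemma redec_idl x y : redec x x * redec x y = redec x y.
Proof.
rewrite redec_id /redec; case: eqP => _; first by rewrite idem_mul eqxx.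
exact: (@idem_source n K (Dec Right _ _ _)).
Qed.

Lemma redec_idr x y : redec x y * redec y y = redec x y.
Proof.
rewrite redec_id /redec; case: eqP => [->|_]; first by rewrite idem_mul eqxx.
exact: (idem_target (Dec Right _ _ _)).
Qed.

End Relations.

(** * States and their boundaries *)

Section States.
Variables (n : nat) (T : right_tangle n).
Local Notation V := (points n T).
Implicit Types (x y z : state T) (C D : {set V}) (rho : {set 'I_(size T)}).

Lemma adjacent_sym md : symmetric (@adjacent n T md).
Proof.
suff H u v : @adjacent n T md u v -> @adjacent n T md v u.
  by move=> u v; apply/idP/idP; apply: H.
case/existsP=> j /existsP[s /existsP[t /and3P[us vt uv]]].
apply/existsP; exists j; apply/existsP; exists t; apply/existsP; exists s.
by rewrite us vt /joined orbC.
Qed.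

Lemma resolved_sym rho : symmetric (@resolved n T rho).
Proof. exact: adjacent_sym. Qed.

Lemma st_rel_sym x : symmetric (st_rel x).
Proof.
suff H u v : st_rel x u v -> st_rel x v u by move=> u v; apply/idP/idP; apply: H.
case/orP=> [|/existsP[p /andP[/eqP -> /eqP ->]]].
  by rewrite resolved_sym => vu; apply/orP; left.
apply/orP; right; apply/existsP; exists ((st_link x).1 p).
by rewrite partnerK !eqxx.
Qed.

Lemma sub_cut_resolved rho : subrel (@cut_rel n T) (resolved rho).
Proof.
have H md sl p q : half_joined Cut sl p q -> half_joined md sl p q.
  by case: sl p q => [i o|i|i] [[] a] [[] b] //=; case: ifP.
move=> u v /existsP[j /existsP[s /existsP[t /and3P[us vt uv]]]].
apply/existsP; exists j; apply/existsP; exists s; apply/existsP; exists t.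
rewrite us vt; case/orP: uv => /H uv; first by rewrite /joined uv.
by rewrite /joined uv orbT.
Qed.

Lemma st_dec_constant x : constant_on (st_rel x) (st_dec x).
Proof.
move=> u v uv; apply/eqP; case: x uv => -[[L rho] s] xP uv.
have /and4P[_ _ sP _] := xP.
exact: (implyP (forallP (forallP sP u) v) uv).
Qed.

Lemma st_dec_marked x p : is_marked p -> ~~ st_dec x (axis T p).
Proof.
case: x => -[[L rho] s] xP; have /and4P[_ _ _ sP] := xP.
exact: (implyP (forallP sP p)).
Qed.

Lemma connect_right x p q :
  connect (resolved (st_res x)) (axis T p) (axis T q) =
  (q \in arc (st_link x).2 p).
Proof.
case: x => -[[L rho] s] xP; have /and4P[_ rhoP _ _] := xP.
exact: (eqP (forallP (forallP rhoP p) q)).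
Qed.

Lemma redecorate z (s : V -> bool) :
  constant_on (st_rel z) s -> (forall p, is_marked p -> ~~ s (axis T p)) ->
  exists y, [/\ st_link y = st_link z, st_res y = st_res z & st_dec y =1 s].
Proof.
move=> sc sm; have yP : is_state (st_link z, st_res z, [ffun u => s u]).
  apply/and4P; split.
  - by case: z {sc} => -[[L rho] t] zP; have /and4P[] := zP.
  - by apply/forallP=> p; apply/forallP=> q; rewrite connect_right.
  - apply/forallP=> u; apply/forallP=> v; apply/implyP=> /sc uv.
    by rewrite !ffunE uv.
  - by apply/forallP=> p; apply/implyP; rewrite ffunE; apply: sm.
exists (State yP); split=> // u; exact: ffunE.
Qed.

Lemma state_eq x y :
  st_link x = st_link y -> st_res x = st_res y -> st_dec x =1 st_dec y -> x = y.
Proof.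
case: x y => [[[L rho] s] xP] [[[L' rho'] s'] yP].
rewrite /st_link /st_res /st_dec /= => EL Er /ffunP Es.
by apply: val_inj; rewrite /= EL Er Es.
Qed.

Lemma eq_st_rel x y :
  st_link x = st_link y -> st_res x = st_res y -> st_rel x = st_rel y.
Proof. by move=> EL Er; rewrite /st_rel EL Er. Qed.

(** The right matching records the connections that the resolution makes between
    points of the axis, so the circles of the boundary are the traces on the axis
    of the cleaved circles. *)
Lemma connect_axis x p q :
  connect (st_rel x) (axis T p) (axis T q) = connect (link_rel (st_link x)) p q.
Proof.
apply/idP/idP; last first.
  case/connectP=> r; elim: r p => [|a r IHr] p /=; first by move=> _ ->.
  case/andP=> pa ra qE; apply: connect_trans (IHr a ra qE).
  case/orP: pa => /eqP ->.
    apply: connect1; apply/orP; right; apply/existsP; exists p.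
    by rewrite !eqxx.
  apply: (@connect_sub _ (resolved (st_res x))).
    by move=> u v uv; apply: connect1; apply/orP; left.
  by rewrite connect_right !inE eqxx orbT.
(* A point reached from [p] is joined, in the right half-plane, to some axis
   point reached from [p] in the link. *)
case/connectP=> r.
have : exists2 p', connect (link_rel (st_link x)) p p' &
    connect (resolved (st_res x)) (axis T p') (axis T p).
  by exists p; apply: connect0.
move: (axis T p) => u; elim: r u => [|v r IHr] u [p' pp' p'u] /=.
  move=> _ uE; move: p'u; rewrite -uE connect_right !inE => /orP[] /eqP -> //.
  by apply: (connect_trans pp'); apply: connect1; rewrite /link_rel /= eqxx orbT.
case/andP=> uv; apply: IHr; case/orP: uv => [uv|].
  by exists p' => //; apply: connect_trans p'u _; apply: connect1.
case/existsP=> a /andP[/eqP ua /eqP ->].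
exists ((st_link x).1 a); last exact: connect0.
apply: (connect_trans pp').
have aE : connect (link_rel (st_link x)) p' a.
  move: p'u; rewrite ua connect_right !inE => /orP[] /eqP -> //.
  by apply: connect1; rewrite /link_rel /= eqxx orbT.
by apply: (connect_trans aE); apply: connect1; rewrite /link_rel /= eqxx.
Qed.

Lemma on_axis_circle x D p :
  D \in components (st_rel x) -> axis T p \in D ->
  on_axis D = component (link_rel (st_link x)) p.
Proof.
move=> Dx pD; apply/setP=> q.
by rewrite !inE (mem_component _ (@st_rel_sym x) Dx pD) connect_axis.
Qed.

Lemma not_free D : ~~ is_free D -> exists p, axis T p \in D.
Proof. by case/set0Pn=> p; rewrite inE; exists p. Qed.

Lemma freeP D p : is_free D -> axis T p \notin D.
Proof. by move/eqP/setP/(_ p); rewrite !inE => ->. Qed.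

Lemma boundary_dec x p : dec_of (boundary x) p = st_dec x (axis T p).
Proof. by rewrite /dec_of /= ffunE. Qed.

Lemma boundary_link x : link_of (boundary x) = st_link x. Proof. by []. Qed.

Lemma boundary_eq x y :
  st_link x = st_link y ->
  (forall p, st_dec x (axis T p) = st_dec y (axis T p)) ->
  boundary x = boundary y.
Proof.
move=> EL Es; apply: val_inj; congr pair; first exact: EL.
by apply/ffunP=> p; rewrite !ffunE.
Qed.

Lemma dec_stepP D x y :
  reflect [/\ D \in components (st_rel x), forall u, u \in D -> st_dec x u,
              st_link y = st_link x, st_res y = st_res x
            & st_dec y =1 lower D (st_dec x)]
    (dec_step D x y).
Proof.
apply: (iffP and5P) => -[A1 A2 A3 A4 A5]; split=> //; try exact/eqP.
- exact/forall_inP.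
- by move=> u; rewrite (eqP A5) ffunE.
- exact/forall_inP.
- by apply/eqP/ffunP=> u; rewrite ffunE A5.
Qed.

Lemma dec_step_targetI D x y y' : dec_step D x y -> dec_step D x y' -> y = y'.
Proof.
case/dec_stepP=> _ _ L1 R1 S1 /dec_stepP[_ _ L2 R2 S2].
by apply: state_eq => [||u]; rewrite ?L1 ?R1 ?S1 ?L2 ?R2 ?S2.
Qed.

Lemma dec_step_sourceI D y y' z : dec_step D y z -> dec_step D y' z -> y = y'.
Proof.
case/dec_stepP=> _ P1 L1 R1 S1 /dec_stepP[_ P2 L2 R2 S2].
apply: state_eq => [||u]; rewrite -?L1 -?R1 -?L2 -?R2 //.
have := S1 u; rewrite S2 /lower; case: (boolP (u \in D)) => uD.
  by rewrite P1 // P2.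
by rewrite !andbT.
Qed.

Lemma dec_step_rel D x y : dec_step D x y -> st_rel y = st_rel x.
Proof. by case/dec_stepP=> _ _ L R _; apply: eq_st_rel. Qed.

Lemma lower_exists D x :
  D \in components (st_rel x) -> (forall u, u \in D -> st_dec x u) ->
  exists y, dec_step D x y.
Proof.
move=> Dx Dp; have [||y [L R S]] := @redecorate x (lower D (st_dec x)).
- move=> u v uv; rewrite /lower (st_dec_constant uv).
  by rewrite (component_closed (@st_rel_sym x) Dx uv).
- by move=> p /(@st_dec_marked x) /negbTE pm; rewrite /lower pm.
by exists y; apply/dec_stepP.
Qed.

Lemma raise_exists D z :
  D \in components (st_rel z) -> (forall u, u \in D -> ~~ st_dec z u) ->
  (forall p, is_marked p -> axis T p \notin D) ->
  exists2 y, dec_step D y z & st_dec y =1 raise D (st_dec z).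
Proof.
move=> Dz Dm mD; have [||y [L R S]] := @redecorate z (raise D (st_dec z)).
- move=> u v uv; rewrite /raise (st_dec_constant uv).
  by rewrite (component_closed (@st_rel_sym z) Dz uv).
- move=> p pm; rewrite /raise negb_or mD // andbT.
  exact: st_dec_marked.
exists y; last exact: S.
apply/dec_stepP; split; [ | | exact/esym | exact/esym | ].
- by rewrite (eq_st_rel L R).
- by move=> u uD; rewrite S /raise uD orbT.
move=> u; rewrite /lower S /raise; case: (boolP (u \in D)) => uD.
  by rewrite andbF (negbTE (Dm u uD)).
by rewrite orbF andbT.
Qed.

Lemma dec_denotes b D x y :
  dec_step D x y -> ~~ is_free D ->
  denotes (Dec b (boundary x) (on_axis D) (boundary y)).
Proof.
case/dec_stepP=> Dx Dp L R S /not_free[p pD]; apply/and4P; split.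
- by rewrite (on_axis_circle Dx pD); apply: mem_components.
- by apply/forall_inP=> q; rewrite inE boundary_dec; apply: Dp.
- by rewrite !boundary_link L.
- by apply/eqP/ffunP=> q; rewrite [RHS]ffunE !boundary_dec S /lower inE.
Qed.

Lemma dec_step_free D x y :
  dec_step D x y -> is_free D -> boundary y = boundary x.
Proof.
case/dec_stepP=> Dx Dp L R S Df; apply: boundary_eq => // p.
by rewrite S /lower freeP // andbT.
Qed.

End States.

(** * Surgery at a crossing *)

Section Crossings.
Variables (n : nat) (T : right_tangle n).
Local Notation V := (points n T).
Implicit Types (x y z : state T) (c : 'I_(size T)) (rho : {set 'I_(size T)}).

Lemma point_eq (u v : V) : line u = line v -> height u = height v -> u = v.
Proof.
case: u v => [j a] [k b]; rewrite /line /height /= => /val_inj jk; subst k.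
by move/val_inj ->.
Qed.

Lemma in_crossing_ends c i o (u : V) :
  slice_at c = Cross i o ->
  (u \in crossing_ends c) =
  ((line u == c) || (line u == c.+1)) &&
    ((height u == i) || (height u == i.+1)).
Proof. by rewrite /crossing_ends => ->; rewrite inE. Qed.

Lemma half_joined_mode md md' i o s t a b :
  half_joined md (Cross i o) (s, a) (t, b) ->
  half_joined md' (Cross i o) (s, a) (t, b) \/
  ((a == i) || (a == i.+1)) && ((b == i) || (b == i.+1)).
Proof.
case: s t => [] [] /=.
- by case: md => // /andP[-> ->]; rewrite orbT; right.
- by case: md.
- case: ifP => [aE|_ ->]; last by left.
  case: md => //= [/eqP -> | /andP[-> _]]; rewrite ?aE; by right.
- by case: md => // /andP[-> ->]; rewrite orbT; right.
Qed.

Lemma resolved_agree c rho rho' :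
  (forall j, j != c -> (j \in rho) = (j \in rho')) ->
  agree_off (crossing_ends c) (@resolved n T rho) (resolved rho').
Proof.
move=> rr; suff H (r r' : {set 'I_(size T)}) (u v : V) :
    (forall j, j != c -> (j \in r) = (j \in r')) ->
    ~~ ((u \in crossing_ends c) && (v \in crossing_ends c)) ->
    @resolved n T r u v -> resolved r' u v.
  by move=> u v uvF; apply/idP/idP; apply: H => // j /rr.
move=> {}rr uvF /existsP[j /existsP[s /existsP[t /and3P[us vt uv]]]].
apply/existsP; exists j; apply/existsP; exists s; apply/existsP; exists t.
rewrite us vt /=; move: uv; case: (eqVneq j c) => [jc|/rr jr]; last first.
  by rewrite /resolution_mode jr.
rewrite {}jc in us vt *; case cE : (slice_at c) => [i o|i|i]; last 2 first.
- by rewrite /resolution_mode cE.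
- by rewrite /resolution_mode cE.
have endE (w : V) (a : bool) : line w == (a + c)%N -> (w \in crossing_ends c) =
    (height w == i) || (height w == i.+1).
  move=> wa; rewrite (in_crossing_ends w cE) (eqP wa).
  by case: a {wa}; rewrite ?add0n ?add1n eqxx ?orbT.
rewrite (endE _ _ us) (endE _ _ vt) in uvF.
rewrite /joined => /orP[] /(@half_joined_mode _ (resolution_mode r' c)) [-> //|].
- by rewrite (negPf uvF).
- by rewrite orbT.
- by rewrite andbC (negPf uvF).
Qed.

(** Two of any three ends of a crossing belong to the same of the two strands of
    the resolution. *)
Lemma crossing_pairs c rho (u v w : V) :
  is_crossing c ->
  u \in crossing_ends c -> v \in crossing_ends c -> w \in crossing_ends c ->
  [|| connect (resolved rho) u v, connect (resolved rho) u w
    | connect (resolved rho) v w].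
Proof.
rewrite /is_crossing; case cE : (slice_at c) => [i o|//|//] _ uF vF wF.
have lineE a : a \in crossing_ends c -> line a = ((line a != c) + c)%N.
  rewrite (in_crossing_ends a cE) => /andP[+ _].
  by case: eqVneq => [-> //|_ /= /eqP].
have heightE a : a \in crossing_ends c -> height a = ((height a != i) + i)%N.
  rewrite (in_crossing_ends a cE) => /andP[_].
  by case: eqVneq => [-> //|_ /= /eqP].
have joinE a b (s t : bool) : line a = (s + c)%N -> line b = (t + c)%N ->
    joined (resolution_mode rho c) (Cross i o) (s, height a) (t, height b) ->
    connect (@resolved n T rho) a b.
  move=> la lb ab; apply: connect1; apply/existsP; exists c.
  apply/existsP; exists s; apply/existsP; exists t.
  by rewrite la lb !eqxx cE.
(* The end [a] is classified by its vertical line or by its height, according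
   to the direction of the strands of the resolution. *)
pose k (a : V) :=
  if resolution_mode rho c is Turn then line a != c else height a != i.
have kE (a b : V) : a \in crossing_ends c -> b \in crossing_ends c -> k a = k b ->
    connect (@resolved n T rho) a b.
  move=> aF bF; have := joinE a b _ _ (lineE a aF) (lineE b bF).
  rewrite /k; have : resolution_mode rho c = Turn \/ resolution_mode rho c = Flat.
    by rewrite /resolution_mode cE; case: ifP; [left|right].
  case=> -> ab kab.
    case: (eqVneq (height a) (height b)) => [hE|hN].
      by rewrite (point_eq _ hE) // (lineE a aF) (lineE b bF) kab.
    apply: ab; rewrite kab (heightE a aF) (heightE b bF) in hN *.
    rewrite /joined /=; case: (line b != c);
    by case: (height a != i) (height b != i) hN => [] [];
      rewrite ?add0n ?add1n !eqxx ?orbT.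
  case: (eqVneq (line a) (line b)) => [lE|lN].
    by rewrite (point_eq lE) // (heightE a aF) (heightE b bF) kab.
  apply: ab; have hE : height a = height b.
    by rewrite (heightE a aF) (heightE b bF) kab.
  have bE : (height b == i) || (height b == i.+1).
    by move: bF; rewrite (in_crossing_ends b cE) => /andP[].
  rewrite (lineE a aF) (lineE b bF) in lN; rewrite hE /joined.
  by case: (line a != c) (line b != c) lN => [] []; rewrite /= ?bE ?eqxx ?orbT.
have [kuv|kuv] := eqVneq (k u) (k v); first by rewrite (kE u v).
have [kuw|kuw] := eqVneq (k u) (k w); first by rewrite (kE u w) ?orbT.
rewrite (kE v w) ?orbT //.
by move: kuv kuw; case: (k u) (k v) (k w) => [] [] [].
Qed.


(** The arcs that are not touched survive the surgery, so they also determine the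
    partners of the two ends of a single touched arc. *)
Lemma right_matching_eq (F : {set V}) x y :
  agree_off F (resolved (st_res x)) (resolved (st_res y)) ->
  (forall p q, axis T p \in touched F (resolved (st_res x)) ->
     axis T q \in touched F (resolved (st_res x)) -> q \in arc (st_link x).2 p) ->
  (st_link y).2 = (st_link x).2.
Proof.
move=> xy one; have eS := @resolved_sym n T (st_res x).
have eS' := @resolved_sym n T (st_res y).
have UE := touched_agree eS eS' xy.
have connE z p :
    connect (resolved (st_res z)) (axis T p) (axis T ((st_link z).2 p)).
  by rewrite connect_right !inE eqxx orbT.
apply: val_inj; apply/ffunP=> p; rewrite -!/(partner _) /=.
have /eqP y_neq := partner_neq (st_link y).2 p.
have /eqP x_neq := partner_neq (st_link x).2 p.
case: (boolP (axis T p \in touched F (resolved (st_res x)))) => pU.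
  have yU : axis T ((st_link y).2 p) \in touched F (resolved (st_res x)).
    by rewrite UE; apply: touched_connect (connE y p) _; rewrite -UE; exact: pU.
  have := one p _ pU yU; rewrite !inE => /orP[] /eqP yE; last exact: yE.
  by case: (y_neq yE).
have := connect_untouched eS xy pU (connE x p).
rewrite connect_right !inE => /orP[] /eqP xE; last exact: esym xE.
by case: (x_neq xE).
Qed.

(** If one of the two strands of the resolution did not reach the axis, then at
    most one arc of the right matching would be touched. *)
Lemma right_matching_changed c x y u :
  is_crossing c ->
  agree_off (crossing_ends c) (resolved (st_res x)) (resolved (st_res y)) ->
  (st_link y).2 != (st_link x).2 -> u \in crossing_ends c ->
  exists p, connect (resolved (st_res x)) (axis T p) u.
Proof.
move=> cc xy xyN uF.
case: (pselect (exists p, connect (resolved (st_res x)) (axis T p) u)) => // uN.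
have eC := sym_connect_sym (@resolved_sym n T (st_res x)).
case/eqP: xyN; apply: right_matching_eq xy _ => p q.
case/touchedP=> v vF vp /touchedP[w wF wq].
case/or3P: (crossing_pairs (st_res x) cc uF vF wF) => uvw.
- by case: uN; exists p; rewrite eC; apply: connect_trans vp.
- by case: uN; exists q; rewrite eC; apply: connect_trans wq.
rewrite -connect_right eC; rewrite eC in wq; rewrite eC in uvw.
exact: connect_trans (connect_trans wq uvw) vp.
Qed.

End Crossings.

(** * Vertical steps and bridges of the boundary *)

Section Squares.
Variables (n : nat) (T : right_tangle n) (K : fieldType).
Local Notation V := (points n T).
Local Notation E := (@elt n K).
Implicit Types (x y z : state T) (C D : {set V}) (F : {set V}).
Implicit Types (A : {set {set pt n}}).

Definition vert_elt x D y : BGamma n K :=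
  if is_free D then idem K (boundary x)
  else E (Dec Right (boundary x) (on_axis D) (boundary y)).

Lemma vert_redec D x y :
  dec_step D x y -> vert_elt x D y = redec K (boundary x) (boundary y).
Proof.
move=> xy; rewrite /vert_elt; case: (boolP (is_free D)) => [Df|Dc].
  by rewrite (dec_step_free xy Df) redec_id.
have [p pD] := not_free Dc.
have [Dx Dp L R S] := dec_stepP _ _ _ xy.
rewrite /redec; case: eqP => [bE|_].
  have := boundary_dec y p; rewrite -bE boundary_dec S /lower pD andbF.
  by rewrite Dp.
congr (E (Dec _ _ _ _)); apply/setP=> q; rewrite !inE !boundary_dec S /lower.
by case: (boolP (axis T q \in D)) => [/Dp ->|]; rewrite ?andbF // andbT andbN.
Qed.

(** This makes a surgery at [F] in the states visible in the boundary as a surgery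
    along the bridge [A]. *)
Definition carried A F (e : rel V) :=
  (forall u, u \in F -> exists2 p, p \in cover A & connect e (axis T p) u) /\
  (forall p, p \in cover A -> exists2 u, u \in F & connect e (axis T p) u).

Lemma carried_merges A F x y (s s' : V -> bool) :
  carried A F (st_rel x) -> carried A F (st_rel y) ->
  constant_on (st_rel x) s -> constant_on (st_rel y) s' ->
  merges F (st_rel x) (st_rel y) s s' ->
  merges (cover A) (link_rel (st_link x)) (link_rel (st_link y))
    (s \o @axis n T) (s' \o @axis n T).
Proof.
move=> [x1 x2] [y1 y2] sc sc' [u [v [uF vF /on_twoP[nuv A1] /on_oneP A2 A3]]].
have eC := sym_connect_sym (@st_rel_sym n T x).
have [p pA pu] := x1 u uF; have [q qA qv] := x1 v vF.
exists p, q; split=> //.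
- apply/on_twoP; rewrite -!connect_axis; split.
    apply: contra nuv => pq; rewrite eC in pu.
    exact: connect_trans (connect_trans pu pq) qv.
  move=> r rA; rewrite -!connect_axis; have [w wF rw] := x2 r rA.
  rewrite eC in rw; case/orP: (A1 w wF) => uw; apply/orP; [left|right].
    exact: connect_trans (connect_trans pu uw) rw.
  exact: connect_trans (connect_trans qv uw) rw.
- apply/on_oneP=> r r' rA r'A; rewrite -connect_axis.
  have [w wF rw] := y2 r rA; have [w' w'F] := y2 r' r'A.
  rewrite (sym_connect_sym (@st_rel_sym n T y)) => r'w.
  exact: connect_trans (connect_trans rw (A2 w w' wF w'F)) r'w.
rewrite /= (constant_connect sc pu) (constant_connect sc qv).
have [w wF pw] := y2 p pA; rewrite (constant_connect sc' pw).
by rewrite (constant_connect sc' (A2 w u wF uF)).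
Qed.

Lemma carried_khovanov A F x y :
  carried A F (st_rel x) -> carried A F (st_rel y) ->
  khovanov (st_rel x) (st_rel y) F (st_dec x) (st_dec y) ->
  khovanov (link_rel (st_link x)) (link_rel (st_link y)) (cover A)
    (dec_of (boundary x)) (dec_of (boundary y)).
Proof.
move=> xA yA /khovanovP[H1 H2].
have : khovanov (link_rel (st_link x)) (link_rel (st_link y)) (cover A)
    (st_dec x \o @axis n T) (st_dec y \o @axis n T).
  apply/khovanovP; split=> [p pU|].
    apply: H1; apply: contra pU => /touchedP[u uF up].
    have [q qA qu] := proj1 xA u uF; apply/touchedP; exists q => //.
    by rewrite -connect_axis; apply: connect_trans up.
  case: H2 => H; [left|right]; apply: (carried_merges _ _ _ _ H) => //.
  - exact: st_dec_constant.
  - exact: st_dec_constant.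
  - by move=> u v /st_dec_constant /= ->.
  - by move=> u v /st_dec_constant /= ->.
by apply: eq_khovanov => p; rewrite boundary_dec.
Qed.

(** The circles [D], [D'] of the vertical steps to be compared, before and after a
    surgery at [F]: away from [F] it is the same circle, while circles touching
    [F] are all compared with each other. *)
Definition paired F D D' :=
  D = D' /\ [disjoint D & F] \/ ~~ [disjoint D & F] /\ ~~ [disjoint D' & F].

Lemma carried_touching A F x D :
  carried A F (st_rel x) -> D \in components (st_rel x) ->
  ~~ [disjoint on_axis D & cover A] = ~~ [disjoint D & F].
Proof.
move=> [x1 x2] Dx; have eC := sym_connect_sym (@st_rel_sym n T x).
apply/idP/idP=> /pred0Pn.
  case=> p /andP[/= + /x2[u uF pu]]; rewrite inE => pD; apply/pred0Pn; exists u.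
  by rewrite /= uF andbT (mem_component _ (@st_rel_sym n T x) Dx pD).
case=> u /andP[uD /= /x1[p pA pu]]; apply/pred0Pn; exists p.
by rewrite /= pA andbT inE (mem_component _ (@st_rel_sym n T x) Dx uD) eC.
Qed.

(** The surgery along [A] in the boundary merges or divides circles exactly as the
    surgery at [F] in the states does, so [R2], [R9_merge] and [R9_divide] apply. *)
Lemma bridge_square b A F x y y' z D D' :
  carried A F (st_rel x) -> carried A F (st_rel y) ->
  side_of (~~ b) (st_link y) = side_of (~~ b) (st_link x) ->
  khovanov (st_rel x) (st_rel y) F (st_dec x) (st_dec y) ->
  khovanov (st_rel y') (st_rel z) F (st_dec y') (st_dec z) ->
  dec_step D x y' -> dec_step D' y z -> paired F D D' ->
  E (Bri b A (boundary x) (boundary y)) * vert_elt y D' z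
  = vert_elt x D y' * E (Bri b A (boundary y') (boundary z)).
Proof.
move=> xA yA side k1 k2 xy' yz DD'.
have [Dx _ L1 R1 _] := dec_stepP _ _ _ xy'.
have [D'y _ L2 R2 _] := dec_stepP _ _ _ yz.
have y'A : carried A F (st_rel y') by rewrite (dec_step_rel xy').
have zA : carried A F (st_rel z) by rewrite (dec_step_rel yz).
have K1 := carried_khovanov xA yA k1; have K2 := carried_khovanov y'A zA k2.
(* Otherwise neither symbol denotes a generator, and both products vanish. *)
case: (boolP (is_bridge (side_of b (st_link x)) A &&
   is_surgery (side_of b (st_link x)) A (side_of b (st_link y)))); last first.
  move=> Q; rewrite !elt0 ?mul0r ?mulr0 //; apply: contra Q.
    by case/and4P; rewrite !boundary_link L1 L2 => -> ->.
  by case/and4P; rewrite !boundary_link => -> ->.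
case/andP=> bA sA.
have d1 : denotes (Bri b A (boundary x) (boundary y)).
  by apply/and4P; split=> //; apply/eqP.
have d2 : denotes (Bri b A (boundary y') (boundary z)).
  by apply/and4P; rewrite -L1 -L2 in bA sA side; split=> //; apply/eqP.
rewrite /vert_elt; case: DD' => [[DE DF]|[DF D'F]].
  rewrite -DE in yz D'y *; case: ifP => Df.
    rewrite (dec_step_free xy' Df) -(dec_step_free yz Df).
    rewrite (idem_target K (Bri b A _ _)).
    by rewrite (@idem_source n K (Bri b A _ _)).
  apply: dec_bridge_disjoint => //; try by apply: dec_denotes; rewrite ?Df.
  by apply: negbNE; rewrite (carried_touching xA Dx) DF.
have cleaved w B : carried A F (st_rel w) -> B \in components (st_rel w) ->
    ~~ [disjoint B & F] -> ~~ is_free B.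
  move=> wA Bw BF; move: (BF); rewrite -(carried_touching wA Bw).
  by apply: contra => /eqP ->; rewrite -setI_eq0 set0I.
have Dc := cleaved x D xA Dx DF; have D'c := cleaved y D' yA D'y D'F.
rewrite (negbTE Dc) (negbTE D'c).
apply: dec_bridge_touching => //; try exact: dec_denotes.
  by rewrite (carried_touching xA Dx).
by rewrite (carried_touching yA D'y).
Qed.

End Squares.

(** * The algebra element of a crossing *)

Section CrossingSquare.
Variables (n : nat) (T : right_tangle n) (K : fieldType).
Local Notation V := (points n T).
Local Notation E := (@elt n K).
Implicit Types (x y z : state T) (C D F : {set V}) (c : 'I_(size T)).

Lemma connect_resolved x u v :
  connect (resolved (st_res x)) u v -> connect (st_rel x) u v.
Proof. by apply: connect_sub => a b ab; apply: connect1; apply/orP; left. Qed.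

Lemma res_bridge_cover c x p :
  (p \in cover (res_bridge c x)) =
  (axis T p \in touched (crossing_ends c) (resolved (st_res x))).
Proof.
have eC := sym_connect_sym (@resolved_sym n T (st_res x)).
apply/bigcupP/touchedP => [[a /imsetP[q qF ->] pq]|[u uF up]].
  move: qF; rewrite inE => /exists_inP[u uF qu]; exists u => //.
  by rewrite -connect_right eC in pq; rewrite eC; apply: connect_trans pq qu.
exists (arc (st_link x).2 p); last by rewrite !inE eqxx.
by apply: imset_f; rewrite inE; apply/exists_inP; exists u => //; rewrite eC.
Qed.

Lemma res_step_agree c x y :
  res_step c x y ->
  agree_off (crossing_ends c) (resolved (st_res x)) (resolved (st_res y)).
Proof.
case/and5P=> _ _ /eqP -> _ _; apply: resolved_agree => j jc.
by rewrite !inE (negPf jc).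
Qed.

Lemma res_carried c x y :
  res_step c x y -> (st_link y).2 != (st_link x).2 ->
  carried (res_bridge c x) (crossing_ends c) (st_rel x) /\
  carried (res_bridge c x) (crossing_ends c) (st_rel y).
Proof.
move=> xy N; have ag := res_step_agree xy; have /and5P[cc _ _ _ _] := xy.
have UE := touched_agree (@resolved_sym n T _) (@resolved_sym n T _) ag.
have H w : touched (crossing_ends c) (resolved (st_res w)) =
      touched (crossing_ends c) (resolved (st_res x)) ->
    (forall u, u \in crossing_ends c ->
       exists p, connect (resolved (st_res w)) (axis T p) u) ->
    carried (res_bridge c x) (crossing_ends c) (st_rel w).
  have eC := sym_connect_sym (@resolved_sym n T (st_res w)).
  move=> wU wP; have coverE p : (p \in cover (res_bridge c x)) =
      (axis T p \in touched (crossing_ends c) (resolved (st_res w))).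
    by rewrite wU; exact: res_bridge_cover.
  split=> [u uF|p].
    have [p pu] := wP u uF; exists p; last exact: connect_resolved.
    by rewrite coverE; apply/touchedP; exists u; [exact: uF | rewrite eC].
  rewrite coverE => /touchedP[u uF up]; exists u; first exact: uF.
  by apply: connect_resolved; rewrite eC.
split; [apply: (H x (erefl _)) | apply: (H y (esym UE))] => u uF.
  exact: right_matching_changed cc ag N uF.
by apply: (right_matching_changed cc (agree_offC ag) _ uF); rewrite eq_sym.
Qed.

Lemma diff_denotes (x y : cleaved_link n) :
  link_of y = link_of x ->
  denotes (Dec Right x [set p | dec_of x p && ~~ dec_of y p] y) =
  ([set p | dec_of x p && ~~ dec_of y p] \in link_circles (link_of x)) &&
  [forall p, dec_of y p ==> dec_of x p].
Proof.
move=> L; rewrite /= /is_dec_step L eqxx; congr (_ && _).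
have -> : [forall i in [set p | dec_of x p && ~~ dec_of y p], dec_of x i].
  by apply/forall_inP=> i; rewrite inE => /andP[].
apply/eqP/forallP=> [H p|H]; last apply/ffunP=> p.
  by apply/implyP; rewrite H ffunE => /andP[].
by rewrite ffunE inE; move: (H p); case: (dec_of x p) (dec_of y p) => [] [].
Qed.

(** The circle [D] is + both before and after the first change, hence is not
    concerned by it; so the two changes commute, by [R1] if both of them are
    visible in the boundary. *)
Lemma redec_square x y y' z D :
  st_link y = st_link x -> dec_step D x y' -> dec_step D y z ->
  redec K (boundary x) (boundary y) * redec K (boundary y) (boundary z)
  = redec K (boundary x) (boundary y') * redec K (boundary y') (boundary z).
Proof.
move=> L xy' yz.
have [_ Px L1 _ S1] := dec_stepP _ _ _ xy'.
have [_ Py L2 _ S2] := dec_stepP _ _ _ yz.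
case: (boolP (is_free D)) => Df.
  rewrite (dec_step_free xy' Df) (dec_step_free yz Df).
  by rewrite redec_idl redec_idr.
case: (eqVneq (boundary x) (boundary y)) => [xyE|xyN].
  suff -> : boundary y' = boundary z by rewrite xyE redec_idl redec_idr.
  apply: boundary_eq => [|p]; first by rewrite L1 L2 L.
  by rewrite S1 S2 /lower -!boundary_dec xyE.
set S := [set p | dec_of (boundary x) p && ~~ dec_of (boundary y) p].
have SE : [set p | dec_of (boundary y') p && ~~ dec_of (boundary z) p] = S.
  apply/setP=> p; rewrite !inE !boundary_dec S1 S2 /lower.
  case: (boolP (axis T p \in D)) => [pD|_]; rewrite ?andbF ?andbT //.
  by rewrite Py // andbF.
have y'zN : boundary y' != boundary z.
  apply: contra xyN => /eqP y'z; apply/eqP; apply: boundary_eq => // p.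
  have := boundary_dec y' p; rewrite y'z boundary_dec S1 S2 /lower.
  by case: (boolP (axis T p \in D)) => [pD|_]; rewrite ?andbT // Px // Py.
rewrite -(vert_redec K xy') -(vert_redec K yz) /vert_elt (negbTE Df) /redec.
rewrite (negbTE xyN) (negbTE y'zN) SE -/S.
have dE : denotes (Dec Right (boundary x) S (boundary y)) =
    denotes (Dec Right (boundary y') S (boundary z)).
  rewrite -{2}SE !diff_denotes ?boundary_link ?L1 ?L2 // SE; congr (_ && _).
  apply: eq_forallb => p; rewrite !boundary_dec S1 S2 /lower.
  case: (boolP (axis T p \in D)) => [pD|_]; rewrite ?andbT //.
  by rewrite Px // implybT andbF.
case: (boolP (denotes (Dec Right (boundary x) S (boundary y)))) => d; last first.
  by have d' := d; rewrite dE in d'; rewrite (elt0 K d) (elt0 K d') mul0r mulr0.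
have d' := d; rewrite dE in d'; apply/elt_rel2/R1 => //; try exact: dec_denotes.
have [p pD] := not_free Df; apply/eqP=> /setP/(_ p).
by rewrite !inE !boundary_dec pD Px // Py.
Qed.

(** The touched circles form a single one before or after the surgery, and points
    of the axis are connected in the same way before and after it. *)
Lemma touched_axis_connect x z F p q :
  agree_off F (st_rel x) (st_rel z) -> st_link z = st_link x ->
  reconnects F (st_rel x) (st_rel z) \/ reconnects F (st_rel z) (st_rel x) ->
  axis T p \in touched F (st_rel x) -> axis T q \in touched F (st_rel x) ->
  connect (st_rel x) (axis T p) (axis T q).
Proof.
move=> ag L R pU qU.
have UE := touched_agree (@st_rel_sym n T x) (@st_rel_sym n T z) ag.
have H w : on_one_circle (st_rel w) F -> axis T p \in touched F (st_rel w) ->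
    axis T q \in touched F (st_rel w) -> connect (st_rel w) (axis T p) (axis T q).
  move=> /on_oneP w1 /touchedP[u uF up] /touchedP[v vF vq].
  rewrite (sym_connect_sym (@st_rel_sym n T w)) in up.
  exact: connect_trans (connect_trans up (w1 u v uF vF)) vq.
case: R => -[u [v [_ _ _ one]]]; last exact: H.
rewrite UE in pU qU; rewrite connect_axis -L -connect_axis.
exact: H one pU qU.
Qed.

(** Since the boundary has at most one touched circle, each intermediate state has
    the boundary of [x] or that of [z]. *)
Lemma redec_near x y y' z F D D' :
  agree_off F (st_rel x) (st_rel z) -> st_link z = st_link x ->
  lowers F (st_rel x) (st_rel z) (st_dec x) (st_dec z) ->
  dec_step D x y' -> dec_step D' y z ->
  ~~ [disjoint D & F] -> ~~ [disjoint D' & F] ->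
  redec K (boundary x) (boundary y) * redec K (boundary y) (boundary z)
  = redec K (boundary x) (boundary y') * redec K (boundary y') (boundary z).
Proof.
move=> ag L [Hin Hout HR] xy' yz DF D'F.
have UE := touched_agree (@st_rel_sym n T x) (@st_rel_sym n T z) ag.
have [Dx Px L1 R1 S1] := dec_stepP _ _ _ xy'.
have [D'y Py L2 R2 S2] := dec_stepP _ _ _ yz.
rewrite -(dec_step_rel yz) in D'y.
have DU u : u \in D -> u \in touched F (st_rel x).
  exact: component_touched (@st_rel_sym n T x) Dx DF.
have D'U u : u \in D' -> u \in touched F (st_rel x).
  by rewrite UE; apply: component_touched (@st_rel_sym n T z) D'y D'F.
have y'E : boundary y' = boundary x \/ boundary y' = boundary z.
  case: (boolP (is_free D)) => [/(dec_step_free xy')|/not_free[q qD]].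
    by left.
  right; apply: boundary_eq => [|p]; first by rewrite L1 L.
  case: (boolP (axis T p \in touched F (st_rel x))) => pU.
    have /andP[_ /negbTE ->] := Hin _ pU; rewrite S1 /lower.
    rewrite (mem_component _ (@st_rel_sym n T x) Dx qD).
    by rewrite (touched_axis_connect ag L HR (DU _ qD) pU) andbF.
  rewrite S1 (Hout _ pU) /lower.
  case: (boolP (axis T p \in D)) => [/DU|]; last by rewrite andbT.
  by rewrite (negPf pU).
have yE : boundary y = boundary x \/ boundary y = boundary z.
  case: (boolP (is_free D')) => [/(dec_step_free yz)|/not_free[q qD]].
    by right.
  left; apply: boundary_eq => [|p]; first by rewrite -L2 L.
  case: (boolP (axis T p \in touched F (st_rel x))) => pU.
    have /andP[-> _] := Hin _ pU; apply: Py.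
    rewrite (mem_component _ (@st_rel_sym n T z) D'y qD).
    rewrite connect_axis L -connect_axis.
    exact: (touched_axis_connect ag L HR (D'U _ qD) pU).
  rewrite -(Hout _ pU) S2 /lower.
  case: (boolP (axis T p \in D')) => [/D'U|]; last by rewrite andbT.
  by rewrite (negPf pU).
by case: y'E => ->; case: yE => ->; rewrite ?redec_idl ?redec_idr.
Qed.

Lemma res_elt_redec c x y :
  (st_link y).2 = (st_link x).2 ->
  res_elt K c x y = redec K (boundary x) (boundary y).
Proof. by move=> L; rewrite /res_elt L eqxx /= /redec eq_sym. Qed.

End CrossingSquare.

(** * Steps commuting with the vertical steps *)

Section Families.
Variables (n : nat) (T : right_tangle n) (K : fieldType).
Variable X : tangle_arc T -> K.
Local Notation V := (points n T).
Local Notation E := (@elt n K).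
Implicit Types (x y z : state T) (C D F : {set V}).

Definition shape x := (st_link x, st_res x).

Definition vert_coef x y : BGamma n K :=
  \sum_(D | dec_step D x y) weight X D *: vert_elt K x D y.

Lemma sum_unique (R : nmodType) (J : finType) (P : pred J) (f : J -> R) j :
  P j -> (forall k, P k -> k = j) -> \sum_(k | P k) f k = f j.
Proof.
move=> Pj Pu; apply: big_pred1 => k; apply/idP/eqP => [/Pu //|->//].
Qed.

Definition commutes_vert (a : state T -> state T -> BGamma n K) := forall x z,
  \sum_y a x y * vert_coef y z = \sum_y vert_coef x y * a y z.

Section Orders.
Variables (step : rel (state T)) (alpha : state T -> state T -> BGamma n K).

Definition after x z D : BGamma n K :=
  \sum_(y | step x y && dec_step D y z) alpha x y * vert_elt K y D z.
Definition before x z D : BGamma n K :=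
  \sum_(y | dec_step D x y && step y z) vert_elt K x D y * alpha y z.

Lemma afterE x y z D : step x y -> dec_step D y z ->
  after x z D = alpha x y * vert_elt K y D z.
Proof.
move=> xy yz; apply: sum_unique; first by rewrite xy.
by move=> y' /andP[_ y'z]; apply: dec_step_sourceI y'z yz.
Qed.

Lemma beforeE x y z D : dec_step D x y -> step y z ->
  before x z D = vert_elt K x D y * alpha y z.
Proof.
move=> xy yz; apply: sum_unique; first by rewrite xy.
by move=> y' /andP[xy' _]; apply: dec_step_targetI xy' xy.
Qed.

Lemma commutes_vert_circles :
  (forall x z, \sum_D weight X D *: after x z D
             = \sum_D weight X D *: before x z D) ->
  commutes_vert (fun x y => if step x y then alpha x y else 0).
Proof.
move=> H x z; transitivity (\sum_D weight X D *: after x z D).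
  transitivity (\sum_y \sum_D if step x y && dec_step D y z
      then weight X D *: (alpha x y * vert_elt K y D z) else 0).
    apply: eq_bigr => y _; rewrite /vert_coef.
    case: ifP => xy; last by rewrite mul0r big1.
    rewrite mulr_sumr big_mkcond; apply: eq_bigr => D _ /=.
    by rewrite presented_scaleAr.
  rewrite exchange_big; apply: eq_bigr => D _.
  by rewrite -big_mkcond scaler_sumr.
rewrite {}H; transitivity (\sum_y \sum_D if dec_step D x y && step y z
    then weight X D *: (vert_elt K x D y * alpha y z) else 0).
  rewrite exchange_big; apply: eq_bigr => D _.
  by rewrite -big_mkcond scaler_sumr.
apply: eq_bigr => y _; rewrite /vert_coef.
case: ifP => yz; last by rewrite mulr0 big1 // => D _; rewrite andbF.
rewrite mulr_suml [RHS]big_mkcond; apply: eq_bigr => D _ /=.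
by rewrite andbT presented_scaleAl.
Qed.

End Orders.

(** Every arc of the diagram lies on one circle. The right hand side is the same
    before and after a surgery, although the circles differ. *)
Lemma weight_touched F (e : rel V) :
  symmetric e -> subrel (@cut_rel n T) e ->
  \sum_(D | (D \in components e) && ~~ [disjoint D & F]) weight X D
  = weight X (touched F e).
Proof.
move=> eS sub; rewrite /weight (exchange_big_dep predT) //=.
rewrite [RHS]big_mkcond; apply: eq_bigr => f _.
have [u fE] : exists u, val f = component (@cut_rel n T) u.
  by case: f => f /= /existsP[u /eqP ->]; exists u.
have uf : u \in val f by rewrite fE component_refl.
case: ifP => [fU|fN].
  have uU := subsetP fU u uf.
  apply: (sum_unique (fun=> X f) (j := component e u)).
    rewrite mem_components; apply/andP; split; last first.
      apply/subsetP=> v; rewrite fE !inE; apply: connect_sub => a b ab.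
      by apply: connect1; apply: sub.
    case/touchedP: uU => w wF; rewrite (sym_connect_sym eS) => uw.
    by apply/pred0Pn; exists w; rewrite /= wF inE uw.
  move=> D /andP[/andP[De _] fD]; apply: component_eq => //.
  exact: (subsetP fD).
apply: big_pred0 => D; apply/negP=> /andP[/andP[De DF] fD].
case/negP: fN; apply/subsetP=> v /(subsetP fD); exact: component_touched.
Qed.

(** The common part of the crossings and of the left bridges: [base] is the
    condition on the underlying links and resolutions, and [alpha x y] is the
    coefficient of the step. *)
Section Family.
Variables (F : {set V}) (base : link n * {set 'I_(size T)} ->
  link n * {set 'I_(size T)} -> bool) (alpha : state T -> state T -> BGamma n K).

Definition family_step x y : bool :=
  base (shape x) (shape y) &&
  khovanov (st_rel x) (st_rel y) F (st_dec x) (st_dec y).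

Hypothesis base_agree : forall x y,
  base (shape x) (shape y) -> agree_off F (st_rel x) (st_rel y).
Hypothesis square : forall x y y' z D D',
  family_step x y -> family_step y' z -> dec_step D x y' -> dec_step D' y z ->
  paired F D D' ->
  alpha x y * vert_elt K y D' z = vert_elt K x D y' * alpha y' z.

Lemma dec_step_shape D x y : dec_step D x y -> shape y = shape x.
Proof. by case/dec_stepP=> _ _ L R _; rewrite /shape L R. Qed.

(** The states joined by a step and a vertical step at a circle touching [F]. *)
Definition opposite_corners x z :=
  base (shape x) (shape z) /\
  lowers F (st_rel x) (st_rel z) (st_dec x) (st_dec z).

Lemma corners_of_dec_step x y z D :
  ~~ [disjoint D & F] -> dec_step D x y -> family_step y z ->
  opposite_corners x z.
Proof.
move=> DF xy /andP[b k]; rewrite (dec_step_shape xy) in b; split=> //.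
have [Dx Px _ _ S] := dec_stepP _ _ _ xy.
rewrite (dec_step_rel xy) in k.
apply: (lower_khovanov (@st_rel_sym n T x) (@st_rel_sym n T z) (base_agree b)
  (@st_dec_constant n T x) (@st_dec_constant n T z) Dx DF Px).
exact: eq_khovanov k.
Qed.

Lemma corners_of_step_dec x y z D :
  ~~ [disjoint D & F] -> family_step x y -> dec_step D y z ->
  opposite_corners x z.
Proof.
move=> DF /andP[b k] yz; rewrite -(dec_step_shape yz) in b; split=> //.
have [Dy Py _ _ S] := dec_stepP _ _ _ yz.
rewrite -(dec_step_rel yz) in Dy k.
apply: (raise_khovanov (@st_rel_sym n T x) (@st_rel_sym n T z) (base_agree b)
  (@st_dec_constant n T x) (@st_dec_constant n T z) Dy DF).
  by move=> u uD; rewrite S /lower uD andbF.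
apply: eq_khovanov k => // u; rewrite /raise S /lower.
by case: (boolP (u \in D)) => [/Py|]; rewrite ?andbT ?orbF // orbT.
Qed.

Lemma corners_dec_step x z D :
  opposite_corners x z -> D \in components (st_rel x) -> ~~ [disjoint D & F] ->
  exists2 y, dec_step D x y & family_step y z.
Proof.
move=> [b l] Dx DF; have [Hin _ _] := l.
have [u uD|y xy] := lower_exists Dx.
  by case/andP: (Hin u (component_touched (@st_rel_sym n T x) Dx DF uD)).
exists y => //; rewrite /family_step (dec_step_shape xy) b (dec_step_rel xy) /=.
have [_ _ _ _ S] := dec_stepP _ _ _ xy.
have := khovanov_lower (@st_rel_sym n T x) (@st_rel_sym n T z) (base_agree b)
  Dx DF l.
by apply: eq_khovanov => // v; rewrite S.
Qed.

Lemma corners_step_dec x z D :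
  opposite_corners x z -> D \in components (st_rel z) -> ~~ [disjoint D & F] ->
  exists2 y, family_step x y & dec_step D y z.
Proof.
move=> [b l] Dz DF; have [Hin _ _] := l; have ag := base_agree b.
have DU u : u \in D -> u \in touched F (st_rel x).
  rewrite (touched_agree (@st_rel_sym n T x) (@st_rel_sym n T z) ag).
  exact: component_touched (@st_rel_sym n T z) Dz DF.
have [u /DU/Hin/andP[] //|p pm|y yz S] := raise_exists Dz.
  apply/negP=> /DU/Hin/andP[]; have := st_dec_marked x pm.
  by move/negbTE ->.
exists y => //; rewrite /family_step -(dec_step_shape yz) b -(dec_step_rel yz) /=.
have := khovanov_raise (@st_rel_sym n T x) (@st_rel_sym n T z) ag Dz DF l.
by apply: eq_khovanov => // v; rewrite S.
Qed.

Lemma step_dec_exchange x y z D :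
  [disjoint D & F] -> family_step x y -> dec_step D y z ->
  exists2 y', dec_step D x y' & family_step y' z.
Proof.
move=> DF /andP[b k] yz; have [Dy Py _ _ S] := dec_stepP _ _ _ yz.
have ag := base_agree b.
have Dx : D \in components (st_rel x).
  by apply: untouched_component (agree_offC ag) DF Dy; apply: st_rel_sym.
have xyD u : u \in D -> st_dec y u = st_dec x u.
  move=> uD; case/khovanovP: k => H _; apply: H.
  exact: component_untouched (@st_rel_sym n T x) Dx DF uD.
have [u uD|y' xy'] := lower_exists Dx; first by rewrite -xyD ?Py.
exists y' => //; have [_ _ _ _ S'] := dec_stepP _ _ _ xy'.
rewrite /family_step (dec_step_shape xy') (dec_step_shape yz) b /=.
rewrite (dec_step_rel xy') (dec_step_rel yz).
apply: (khovanov_off (D := D)) k => // u uD; rewrite ?S ?S' /lower uD ?andbT //.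
by rewrite !andbF.
Qed.

Lemma dec_step_exchange x y z D :
  [disjoint D & F] -> dec_step D x y -> family_step y z ->
  exists2 y', family_step x y' & dec_step D y' z.
Proof.
move=> DF xy /andP[b k]; have [Dx Px _ _ S] := dec_stepP _ _ _ xy.
rewrite (dec_step_shape xy) in b; rewrite (dec_step_rel xy) in k.
have ag := base_agree b.
have Dz : D \in components (st_rel z).
  by apply: untouched_component ag DF Dx; apply: st_rel_sym.
have zD u : u \in D -> ~~ st_dec z u.
  move=> uD; case/khovanovP: k => H _; rewrite H ?S /lower ?uD ?andbF //.
  exact: component_untouched (@st_rel_sym n T x) Dx DF uD.
have [//|p pm|y' y'z S'] := raise_exists Dz.
  by apply/negP=> /Px; apply/negP; apply: st_dec_marked.
exists y' => //.
rewrite /family_step -(dec_step_shape y'z) b -(dec_step_rel y'z) /=.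
apply: (khovanov_off (D := D)) k => // u uD;
  rewrite ?S ?S' /lower /raise ?uD ?andbT ?orbF //.
  by rewrite (negbTE uD) orbF.
by rewrite orbT Px.
Qed.

Local Notation after := (after family_step alpha).
Local Notation before := (before family_step alpha).

Lemma after_before_far x z D : [disjoint D & F] -> after x z D = before x z D.
Proof.
move=> DF.
have [[y [xy yz]]|no] := pselect (exists y, family_step x y /\ dec_step D y z).
  have [y' xy' y'z] := step_dec_exchange DF xy yz.
  rewrite (afterE alpha xy yz) (beforeE alpha xy' y'z).
  by apply: square xy' yz _ => //; left.
rewrite /after /before !big_pred0 // => y; apply/negP=> /andP[].
  move=> xy yz; have [y' xy' y'z] := dec_step_exchange DF xy yz.
  by apply: no; exists y'.
by move=> xy yz; apply: no; exists y.
Qed.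

(** Either there is no product at all, or all of them have the same value and, in
    both orders, the circles are all those contained in the touched region. *)
Lemma after_before_near x z :
  \sum_(D : {set V} | ~~ [disjoint D & F]) weight X D *: after x z D
  = \sum_(D : {set V} | ~~ [disjoint D & F]) weight X D *: before x z D.
Proof.
have [S|no] := pselect (opposite_corners x z); last first.
  rewrite !big1 // => D DF; rewrite /after /before big_pred0 ?scaler0 // => y;
    apply/negP=> /andP[xy yz]; apply: no.
    exact: corners_of_dec_step xy yz.
  exact: corners_of_step_dec xy yz.
have [b [Hin Hout R]] := S; have ag := base_agree b.
have [u uF] : exists u, u \in F by case: R => -[u [v [uF _ _ _]]]; exists u.
have near w : ~~ [disjoint component (st_rel w) u & F].
  by apply/pred0Pn; exists u; rewrite /= uF component_refl.
have [y0 xy0 y0z] := corners_dec_step S (mem_components (st_rel x) u) (near x).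
have [y1 xy1 y1z] := corners_step_dec S (mem_components (st_rel z) u) (near z).
(* By [square], another choice of circle would give the same [g]. *)
pose g := alpha x y1 * vert_elt K y1 (component (st_rel z) u) z.
have afterP (D : {set V}) : ~~ [disjoint D & F] -> after x z D =
    if D \in components (st_rel z) then g else 0.
  move=> DF; case: ifP => Dz.
    have [y xy yz] := corners_step_dec S Dz DF; rewrite (afterE alpha xy yz) /g.
    rewrite (square xy y0z xy0 yz); last by right.
    by rewrite (square xy1 y0z xy0 y1z) //; right.
  rewrite /after big_pred0 // => y; apply/negP=> /andP[_ yz].
  by case/dec_stepP: (yz) => Dy _ _ _ _; rewrite (dec_step_rel yz) Dy in Dz.
have beforeP (D : {set V}) : ~~ [disjoint D & F] -> before x z D =
    if D \in components (st_rel x) then g else 0.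
  move=> DF; case: ifP => Dx.
    have [y xy yz] := corners_dec_step S Dx DF; rewrite (beforeE alpha xy yz) /g.
    by rewrite (square xy1 yz xy y1z) //; right.
  rewrite /before big_pred0 // => y; apply/negP=> /andP[xy _].
  by case/dec_stepP: xy; rewrite Dx.
have sumE w (f : {set V} -> BGamma n K) :
    (forall D : {set V}, ~~ [disjoint D & F] ->
     f D = if D \in components (st_rel w) then g else 0) ->
    \sum_(D : {set V} | ~~ [disjoint D & F]) weight X D *: f D
    = weight X (touched F (st_rel w)) *: g.
  move=> fE; rewrite -weight_touched; last 2 first.
  - exact: st_rel_sym.
  - by move=> a c ac; apply/orP; left; apply: sub_cut_resolved.
  rewrite scaler_suml [RHS](eq_bigl _ _ (fun D => andbC _ _)) big_mkcondr.
  apply: eq_bigr => D DF; rewrite fE //.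
  by case: ifP => _; rewrite ?scaler0.
rewrite (sumE z _ afterP) (sumE x _ beforeP).
by rewrite (touched_agree (@st_rel_sym n T x) (@st_rel_sym n T z) ag).
Qed.

Lemma family_commutes :
  commutes_vert (fun x y => if family_step x y then alpha x y else 0).
Proof.
apply: commutes_vert_circles => x z.
rewrite (bigID (fun D : {set V} => [disjoint D & F])) /=.
rewrite [RHS](bigID (fun D : {set V} => [disjoint D & F])) /=.
congr (_ + _); last exact: after_before_near.
by apply: eq_bigr => D DF; rewrite after_before_far.
Qed.

End Family.

Lemma dec_step_swap x y z C D :
  dec_step C x y -> dec_step D y z ->
  exists2 y', dec_step D x y' & dec_step C y' z.
Proof.
move=> xy yz; have [Cx Px L1 R1 S1] := dec_stepP _ _ _ xy.
have [Dy Py L2 R2 S2] := dec_stepP _ _ _ yz; rewrite (dec_step_rel xy) in Dy.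
have eS := @st_rel_sym n T x.
have CD u : u \in C -> u \notin D.
  by move=> uC; apply/negP=> /Py; rewrite S1 /lower uC andbF.
have [u /Py|y' xy'] := lower_exists Dy; first by rewrite S1 => /andP[].
exists y' => //; have [_ _ L3 R3 S3] := dec_stepP _ _ _ xy'.
apply/dec_stepP; split.
- by rewrite (dec_step_rel xy').
- by move=> u uC; rewrite S3 /lower Px // CD.
- by rewrite L2 L1 L3.
- by rewrite R2 R1 R3.
by move=> u; rewrite S2 /lower S1 S3 /lower andbAC.
Qed.

Lemma left_dec_commutes C : ~~ is_free C ->
  commutes_vert (fun x y => if dec_step C x y then
    E (Dec Left (boundary x) (on_axis C) (boundary y)) else 0).
Proof.
move=> Cc; apply: commutes_vert_circles => x z; apply: eq_bigr => D _.
congr (_ *: _).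
have [[y [xy yz]]|no] := pselect (exists y, dec_step C x y /\ dec_step D y z);
  last first.
  rewrite /after /before !big_pred0 // => y; apply/negP=> /andP[xy yz];
    apply: no.
    by have [y' xy' y'z] := dec_step_swap xy yz; exists y'.
  by exists y.
have [y' xy' y'z] := dec_step_swap xy yz.
rewrite (afterE _ xy yz) (beforeE _ xy' y'z) /vert_elt; case: ifP => Df.
  rewrite (dec_step_free xy' Df) (dec_step_free yz Df).
  rewrite (idem_target K (Dec Left _ _ _)).
  by rewrite (@idem_source n K (Dec Left _ _ _)).
apply/elt_rel2/R1; try (by apply: dec_denotes; rewrite ?Df).
have [p pC] := not_free Cc; apply/eqP=> /setP/(_ p); rewrite !inE pC => /esym pD.
have [_ _ _ _ S] := dec_stepP _ _ _ xy; have [_ P _ _ _] := dec_stepP _ _ _ yz.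
by have := P _ pD; rewrite S /lower pC andbF.
Qed.

Lemma commutes_vertD a a' :
  commutes_vert a -> commutes_vert a' ->
  commutes_vert (fun x y => a x y + a' x y).
Proof.
move=> H H' x z; under eq_bigr do rewrite mulrDl.
by under [RHS]eq_bigr do rewrite mulrDr; rewrite !big_split H H'.
Qed.

Lemma commutes_vert_sum (J : finType) (P : pred J)
    (a : J -> state T -> state T -> BGamma n K) :
  (forall j, P j -> commutes_vert (a j)) ->
  commutes_vert (fun x y => \sum_(j | P j) a j x y).
Proof.
move=> H x z; under eq_bigr do rewrite mulr_suml.
under [RHS]eq_bigr do rewrite mulr_sumr.
by rewrite exchange_big [RHS]exchange_big; apply: eq_bigr => j /H.
Qed.

End Families.

(** * Crossings and left bridges commute with the vertical steps *)

Section Steps.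
Variables (n : nat) (T : right_tangle n) (K : fieldType).
Variable X : tangle_arc T -> K.
Local Notation V := (points n T).
Local Notation E := (@elt n K).
Implicit Types (x y z : state T) (C D F : {set V}) (c : 'I_(size T)).
Implicit Types (A : {set {set pt n}}) (m : matching n).

Lemma right_matching_res x y :
  st_res y = st_res x -> (st_link y).2 = (st_link x).2.
Proof.
move=> R; apply: (@right_matching_eq n T set0) => [u v _|p q /touchedP[u]].
  by rewrite R.
by rewrite inE.
Qed.

Lemma res_square c x y y' z D D' :
  res_step c x y -> res_step c y' z -> dec_step D x y' -> dec_step D' y z ->
  paired (crossing_ends c) D D' ->
  agree_off (crossing_ends c) (st_rel x) (st_rel z) ->
  res_elt K c x y * vert_elt K y D' z = vert_elt K x D y' * res_elt K c y' z.
Proof.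
move=> xy y'z xy' yz DD' ag.
have [Dx Px L1 R1 S1] := dec_stepP _ _ _ xy'.
have [D'y Py L2 R2 S2] := dec_stepP _ _ _ yz.
have /and5P[_ _ _ /eqP EL k1] := xy; have /and5P[_ _ _ _ k2] := y'z.
case: (eqVneq (st_link y).2 (st_link x).2) => [ER|NR]; last first.
  have [cx cy] := res_carried xy NR.
  rewrite /res_elt NR L1 L2 NR /res_bridge L1 R1.
  exact: (bridge_square K (b := Right) cx cy EL k1 k2 xy' yz DD').
have L : st_link y = st_link x.
  by move: EL ER; case: (st_link y) (st_link x) => [? ?] [? ?] /= -> ->.
rewrite !res_elt_redec ?L1 ?L2 // (vert_redec K xy') (vert_redec K yz).
case: DD' => [[DE _]|[DF D'F]].
  by rewrite -DE in yz; apply: redec_square xy' yz.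
apply: (redec_near K ag _ _ xy' yz DF D'F); first by rewrite L2.
rewrite (dec_step_rel xy') in k2.
apply: (lower_khovanov (@st_rel_sym n T x) (@st_rel_sym n T z) ag
  (@st_dec_constant n T x) (@st_dec_constant n T z) Dx DF Px).
exact: eq_khovanov k2.
Qed.

Lemma res_commutes c :
  commutes_vert X (fun x y => if res_step c x y then res_elt K c x y else 0).
Proof.
pose base (p q : link n * {set 'I_(size T)}) :=
  [&& is_crossing c, c \notin p.2, q.2 == c |: p.2 & q.1.1 == p.1.1].
have stepE x y : res_step c x y = family_step (crossing_ends c) base x y.
  by rewrite /family_step -!andbA.
have agree x y : base (shape x) (shape y) ->
    agree_off (crossing_ends c) (st_rel x) (st_rel y).
  case/and4P=> _ _ /eqP /= R /eqP /= L u v uv.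
  rewrite /st_rel /glued /= L R; congr (_ || _); move: u v uv.
  by apply: resolved_agree => j jc; rewrite !inE (negPf jc).
have := @family_commutes n T K X (crossing_ends c) base (res_elt K c) agree.
move=> H x z; under eq_bigr do rewrite stepE.
under [RHS]eq_bigr do rewrite stepE.
apply: H => {}x y y' {}z D D'; rewrite -!stepE => xy y'z xy' yz DD'.
apply: (res_square xy y'z xy' yz DD'); rewrite -(dec_step_rel xy').
by apply: agree; move: y'z; rewrite stepE => /andP[].
Qed.

Lemma left_commutes A :
  commutes_vert X (fun x y => if left_step A x y then
    E (Bri Left A (boundary x) (boundary y)) else 0).
Proof.
pose F := [set axis T p | p in cover A].
pose base (p q : link n * {set 'I_(size T)}) :=
  [&& is_bridge p.1.1 A, is_surgery p.1.1 A q.1.1 & q.2 == p.2].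
have stepE x y : left_step A x y = family_step F base x y.
  by rewrite /family_step -!andbA.
have agree x y : base (shape x) (shape y) -> agree_off F (st_rel x) (st_rel y).
  case/and3P=> bA sA /eqP /= R u v uv.
  rewrite /st_rel /glued /= R; congr (_ || _).
  apply: eq_existsb => p; case: eqP => //= uE; rewrite uE in uv *.
  move/forallP/(_ p): sA; case: ifP => pA; last by move/eqP ->.
  rewrite in_setD => /andP[_ p'A].
  apply/eqP/eqP=> vE; case/negP: uv; rewrite vE !imset_f //.
  exact: bridge_cover bA pA.
have car e : carried A F e.
  split=> [u /imsetP[p pA ->]|p pA]; first by exists p; rewrite ?connect0.
  by exists (axis T p); rewrite ?connect0 ?imset_f.
have := @family_commutes n T K X F base
  (fun x y => E (Bri Left A (boundary x) (boundary y))) agree.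
move=> H x z; under eq_bigr do rewrite stepE.
under [RHS]eq_bigr do rewrite stepE.
apply: H => {}x y y' {}z D D' /andP[b1 k1] /andP[b2 k2] xy' yz DD'.
apply: (bridge_square K (b := Left) (car _) (car _) _ k1 k2 xy' yz DD').
by apply: right_matching_res; case/and3P: b1 => _ _ /eqP.
Qed.

Definition total_coef x y : BGamma n K :=
  (\sum_c (if res_step c x y then res_elt K c x y else 0)
   + \sum_A (if left_step A x y then
       E (Bri Left A (boundary x) (boundary y)) else 0))
  + \sum_(C : {set V} | ~~ is_free C) (if dec_step C x y then
      E (Dec Left (boundary x) (on_axis C) (boundary y)) else 0).

Lemma total_commutes : commutes_vert X total_coef.
Proof.
apply: commutes_vertD; last by apply: commutes_vert_sum; apply: left_dec_commutes.
apply: commutes_vertD; apply: commutes_vert_sum => ? _.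
  exact: res_commutes.
exact: left_commutes.
Qed.

End Steps.

(** * Composition of structure maps *)

Section Composition.
Variables (n : nat) (K : fieldType) (S : finType) (bd : S -> cleaved_link n).
Local Notation N := (free_imod K bd).
Implicit Types (x y z : S) (a b : S -> S -> BGamma n K).

Lemma pure_sum (J : finType) (P : pred J) (f : J -> BGamma n K) (v : N) :
  pure (\sum_(j | P j) f j) v = \sum_(j | P j) pure (f j) v.
Proof.
apply: (big_morph (fun t => pure t v)); last exact: pure0l.
by move=> ? ?; apply: pureDl.
Qed.

Lemma sum_pure (J : finType) (P : pred J) (step : J -> rel S)
    (f : J -> S -> S -> BGamma n K) x :
  \sum_(j | P j) \sum_(y | step j x y) pure (f j x y) (basis K bd y) =
  \sum_y pure (\sum_(j | P j) (if step j x y then f j x y else 0)) (basis K bd y).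
Proof.
under [RHS]eq_bigr do rewrite pure_sum.
rewrite [RHS]exchange_big; apply: eq_bigr => j _.
by rewrite [LHS]big_mkcond; apply: eq_bigr => y _; case: ifP; rewrite ?pure0l.
Qed.

Lemma extend_basis (d : S -> tensor N) dI x :
  @extend n K S bd d dI (basis K bd x) = d x.
Proof.
rewrite /= /extend_fun (bigD1 x) //= big1 => [|y yx].
  by rewrite ffunE eqxx scale1r addr0.
by rewrite ffunE (negPf yx) scale0r.
Qed.

Lemma compose_extend a b (d d' : S -> tensor N) dI d'I (v : N) :
  (forall x, d x = \sum_y pure (a x y) (basis K bd y)) ->
  (forall x, d' x = \sum_y pure (b x y) (basis K bd y)) ->
  mu_tens N (idtens (@extend n K S bd d' d'I) (@extend n K S bd d dI v)) =
  \sum_x ((v : free_fun K S) x : K) *: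
    \sum_z pure (\sum_y a x y * b y z) (basis K bd z).
Proof.
move=> dE d'E; rewrite [X in idtens _ X]/= /extend_fun !linear_sum.
apply: eq_bigr => x _; rewrite !linearZZ; congr (_ *: _); rewrite dE !linear_sum.
under [RHS]eq_bigr do rewrite pure_sum.
rewrite [RHS]exchange_big; apply: eq_bigr => y _.
rewrite idtens_pure extend_basis d'E /mu_tens lift_pure /mu_phi linear_sum.
by apply: eq_bigr => z _; rewrite lmul_pure.
Qed.

End Composition.

Section Main.
Variables (n : nat) (T : right_tangle n) (K : fieldType).
Variable X : tangle_arc T -> K.

Lemma deltaT_coef x :
  deltaT_basis K x = \sum_y pure (total_coef K x y) (basis K (@boundary n T) y).
Proof.
rewrite /deltaT_basis.
rewrite (sum_pure _ _ (fun c x y => res_step c x y)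
  (fun c x y => res_elt K c x y)).
rewrite (sum_pure _ _ (fun A x y => left_step A x y)
  (fun A x y => elt K (Bri Left A (boundary x) (boundary y)))).
rewrite (sum_pure _ _ (fun C x y => dec_step C x y)
  (fun C x y => elt K (Dec Left (boundary x) (on_axis C) (boundary y)))).
by rewrite -!big_split; apply: eq_bigr => y _; rewrite /= !pureDl.
Qed.

Lemma deltaV_coef x :
  deltaV_basis X x = \sum_y pure (vert_coef X x y) (basis K (@boundary n T) y).
Proof.
rewrite /deltaV_basis.
rewrite (sum_pure _ _ (fun C x y => dec_step C x y)
  (fun C x y => weight X C *: idem K (boundary x))).
rewrite (sum_pure _ _ (fun C x y => dec_step C x y)
  (fun C x y => weight X C *:
     elt K (Dec Right (boundary x) (on_axis C) (boundary y)))).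
rewrite -big_split; apply: eq_bigr => y _; rewrite /= -pureDl; congr (pure _ _).
rewrite /vert_coef [RHS]big_mkcond [RHS](bigID (@is_free n T)) /=.
by congr (_ + _); apply: eq_bigr => C Cf; rewrite /vert_elt ?Cf ?(negbTE Cf).
Qed.

Lemma deltas_commute (v : Dmod T K) :
  mu_tens (Dmod T K) (idtens (deltaV_over X) (deltaT_over T K v))
  = mu_tens (Dmod T K) (idtens (deltaT_over T K) (deltaV_over X v)).
Proof.
rewrite (compose_extend _ _ v deltaT_coef deltaV_coef).
rewrite (compose_extend _ _ v deltaV_coef deltaT_coef).
apply: eq_bigr => x _; congr (_ *: _); apply: eq_bigr => z _; congr (pure _ _).
exact: total_commutes.
Qed.

End Main.

Lemma addbb (K : fieldType) (W : lmodType K) (t : W) :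
  1 + 1 = 0 :> K -> t + t = 0.
Proof. by move=> K2; rewrite -[t]scale1r -scalerDl K2 scale0r. Qed.

Lemma coef_field_char2 n (T : right_tangle n) : 1 + 1 = 0 :> coef_field T.
Proof.
have F2 : 1 + 1 = 0 :> 'F_2 by apply: val_inj.
have M2 := addbb (1 : {mpoly 'F_2[#|tangle_arc T|]}) F2.
have := congr1 (@tofrac (coef_ring T)) M2.
by rewrite rmorphD rmorph1 rmorph0.
Qed.

Theorem proposition15 (n : nat) (n_gt0 : (0 < n)%N) (T : right_tangle n)
    (v : D T) :
  mu_tens (D T) (idtens (deltaV T) (deltaT T v))
    + mu_tens (D T) (idtens (deltaT T) (deltaV T v)) = 0.
Proof. by rewrite deltas_commute; apply: addbb; apply: coef_field_char2. Qed.
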